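(* Let $k$ be a field, let $(E,R)$ be a finite poset, let $A=\mathrm{Aut}(E,R)$, and let $V$ be a simple left $kA$-module. The morphism of correspondence functors $\Psi:\mathbb{S}_{E,R}\otimes_{kA}V\to S_{E,R,V}$ is an isomorphism.
   Context: **Correspondences.** For finite sets $X,Y$, $\mathcal{C}(Y,X)$ is the set of all subsets of $Y\times X$; composition of $S\subseteq Z\times Y$ and $Q\subseteq Y\times X$ is $SQ=\{(z,x)\mid\exists y\in Y,\ (z,y)\in S,\ (y,x)\in Q\}$. $k\mathcal{C}(Y,X)$ is the free $k$-module on $\mathcal{C}(Y,X)$, with bilinear composition; $k\mathcal{C}(E,E)$ is a $k$-algebra. $\Delta_E=\{(e,e)\mid e\in E\}$ and, for a permutation $\alpha$ of $E$, $\Delta_\alpha=\{(\alpha(e),e)\mid e\in E\}$. A correspondence functor is a $k$-linear functor from the category with objects the finite sets and morphisms $X\to Y$ the elements of $k\mathcal{C}(Y,X)$, to $k$-modules. **Fundamental functors.** A poset $(E,R)$ is a finite set $E$ with a partial order $R\subseteq E\times E$, $(a,b)\in R$ meaning $a\leq b$. The fundamental module $\mathcal{P}_Ef_R$ is the left $k\mathcal{C}(E,E)$-module which is $k$-free with basis $\{\Delta_\alpha f_R\}$, $\alpha$ running over the permutations of $E$ ($f_R:=\Delta_{\mathrm{id}}f_R$), where a relation $Q\in\mathcal{C}(E,E)$ acts by $Q\cdot\Delta_\alpha f_R=\Delta_{\beta\alpha}f_R$ if there is a (necessarily unique) permutation $\beta$ with $\Delta_E\subseteq\Delta_{\beta^{-1}}Q\subseteq{}^{\alpha}R:=\{(\alpha(e),\alpha(f))\mid(e,f)\in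 R\}$, and $Q\cdot\Delta_\alpha f_R=0$ otherwise. It is a bimodule with right action of $\tau\in\mathrm{Aut}(E,R)$ given by $\Delta_\alpha f_R\cdot\tau=\Delta_{\alpha\tau}f_R$. For a left $k\mathcal{C}(E,E)$-module $W$, $L_{E,W}(X)=k\mathcal{C}(X,E)\otimes_{k\mathcal{C}(E,E)}W$ and $J_{E,W}(X)=\{\sum_i\varphi_i\otimes w_i\mid\forall\rho\in k\mathcal{C}(E,X),\ \sum_i(\rho\varphi_i)\cdot w_i=0\}$; these are correspondence functors via left composition. The fundamental functor is $\mathbb{S}_{E,R}=L_{E,\mathcal{P}_Ef_R}/J_{E,\mathcal{P}_Ef_R}$; the right action of $kA$ on $\mathcal{P}_Ef_R$ induces one on each $\mathbb{S}_{E,R}(X)$, commuting with the left action of correspondences. For a left $kA$-module $V$, put $S_{E,R,V}=L_{E,W}/J_{E,W}$ with $W=\mathcal{P}_Ef_R\otimes_{kA}V$. **The morphism $\Psi$.** The functor $\mathbb{S}_{E,R}\otimes_{kA}V$ is $X\mapsto\mathbb{S}_{E,R}(X)\otimes_{kA}V$. The identification $L_{E,\mathcal{P}_Ef_R}(X)\otimes_{kA}V=L_{E,\mathcal{P}_Ef_R\otimes_{kA}V}(X)$ maps the image of $J_{E,\mathcal{P}_Ef_R}(X)\otimes_{kA}V$ into $J_{E,\mathcal{P}_Ef_R\otimes_{kA}V}(X)$, and $\Psi_X$ is the induced (surjective) map on quotients: $\Psi_X\big([\varphi\otimes m]\otimes v\big)=[\varphi\otimes(m\otimes v)]$ for $\varphi\in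 k\mathcal{C}(X,E)$, $m\in\mathcal{P}_Ef_R$, $v\in V$. *)

(* Defs.v *)
From HB Require Import structures.
From mathcomp Require Import all_boot all_order all_algebra all_fingroup.
From mathcomp Require Import generic_quotient ring_quotient.
From mathcomp Require Import boolp.
From mathcomp Require Import freeg.

Set Implicit Arguments.
Unset Strict Implicit.
Unset Printing Implicit Defensive.

Import GRing.Theory.
Local Open Scope ring_scope.
Local Open Scope quotient_scope.

Section Linear.
Variable k : comNzRingType.
Implicit Types U V W : lmodType k.

Lemma linear_map0 U V (f : U -> V) : linear f -> f 0 = 0.
Proof.
move=> lf; have := lf 1 0 0; rewrite !scale1r addr0 => e.
by apply: (addrI (f 0)); rewrite -e addr0.
Qed.

Lemma linear_mapP U V (f : U -> V) : linear f ->
  forall a x y, f (a *: x + y) = a *: f x + f y.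
Proof. by []. Qed.

Lemma linear_mapD U V (f : U -> V) : linear f -> {morph f : x y / x + y}.
Proof. by move=> lf x y; have := lf 1 x y; rewrite !scale1r. Qed.

Lemma linear_mapZ U V (f : U -> V) : linear f -> forall a, {morph f : x / a *: x}.
Proof. by move=> lf a x; have := lf a x 0; rewrite !addr0 (linear_map0 lf) addr0. Qed.

Lemma linear_mapB U V (f : U -> V) : linear f -> {morph f : x y / x - y}.
Proof.
by move=> lf x y; rewrite (linear_mapD lf) -scaleN1r (linear_mapZ lf) scaleN1r.
Qed.

Lemma linear_map_sum U V (f : U -> V) : linear f ->
  forall I (r : seq I) (P : pred I) F,
  f (\sum_(i <- r | P i) F i) = \sum_(i <- r | P i) f (F i).
Proof.
move=> lf I r P F; apply: (big_morph f (linear_mapD lf)).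
exact: linear_map0.
Qed.

Lemma linear_id V : linear (fun x : V => x).
Proof. by []. Qed.

Lemma linear_lincomb U V a (f g : U -> V) :
  linear f -> linear g -> linear (fun x => a *: f x + g x).
Proof.
by move=> lf lg b x y; rewrite lf lg !scalerDr !scalerA mulrC addrACA.
Qed.

Lemma linear_comp U V W (f : V -> W) (g : U -> V) :
  linear f -> linear g -> linear (fun x => f (g x)).
Proof. by move=> lf lg a x y; rewrite lg lf. Qed.

End Linear.

(* An alias hiding the pointwise ring structure of {ffun T -> k}: the free
   k-module on T carries other products below. *)
Definition fmod (k : comNzRingType) (T : finType) : Type := {ffun T -> k^o}.

HB.instance Definition _ k T := GRing.Lmodule.copy (fmod k T) {ffun T -> k^o}.

Section FreeModule.
Variable k : comNzRingType.
Implicit Types (T : finType) (V : lmodType k).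

Definition fcoef T (a : fmod k T) (x : T) : k := (a : {ffun T -> k^o}) x.

Lemma fcoefP T c (a b : fmod k T) x :
  fcoef (c *: a + b) x = c * fcoef a x + fcoef b x.
Proof. by rewrite /fcoef !ffunE. Qed.

Definition basis T (x : T) : fmod k T := [ffun y => (y == x)%:R].

Definition fext T V (f : T -> V) (a : fmod k T) : V :=
  \sum_x fcoef a x *: f x.

Lemma fext_linear T V (f : T -> V) : linear (fext f).
Proof.
move=> c a b; rewrite /fext scaler_sumr -big_split /=; apply: eq_bigr => x _.
by rewrite fcoefP scalerDl scalerA.
Qed.

Lemma fext_basis T V (f : T -> V) x : fext f (basis x) = f x.
Proof.
rewrite /fext (bigD1 x) //= /fcoef ffunE eqxx scale1r big1 ?addr0 // => y /negPf yx.
by rewrite ffunE yx scale0r.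
Qed.

Lemma fmod_decomp T (a : fmod k T) :
  a = \sum_x fcoef a x *: basis x.
Proof.
apply/ffunP => y; rewrite sum_ffunE /fcoef (bigD1 y) //= !ffunE eqxx.
rewrite big1 ?addr0 => [|x /negPf xy]; first by rewrite /GRing.scale /= mulr1.
by rewrite !ffunE eq_sym xy /GRing.scale /= mulr0.
Qed.

Lemma fmod_ext T V (f g : fmod k T -> V) : linear f -> linear g ->
  (forall x, f (basis x) = g (basis x)) -> forall a, f a = g a.
Proof.
move=> lf lg fg a; rewrite [a]fmod_decomp !linear_map_sum //.
by apply: eq_bigr => x _; rewrite !linear_mapZ // fg.
Qed.

Definition fbil T1 T2 V (f : T1 -> T2 -> V) (a : fmod k T1) (b : fmod k T2) :=
  fext (fun x => fext (f x) b) a.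

Lemma fbil_basis T1 T2 V (f : T1 -> T2 -> V) x y :
  fbil f (basis x) (basis y) = f x y.
Proof. by rewrite /fbil !fext_basis. Qed.

Lemma fbil_linearl T1 T2 V (f : T1 -> T2 -> V) b : linear (fun a => fbil f a b).
Proof. exact: fext_linear. Qed.

Lemma fbil_linearr T1 T2 V (f : T1 -> T2 -> V) a : linear (fbil f a).
Proof.
move=> c b b'; rewrite /fbil {1 3 5}/fext scaler_sumr -big_split /=.
apply: eq_bigr => x _; rewrite (linear_mapP (fext_linear (f x))).
by rewrite scalerDr !scalerA mulrC.
Qed.

Lemma basis_neq0 T (x : T) : basis x != 0.
Proof.
apply/eqP => /ffunP/(_ x); rewrite !ffunE eqxx => /eqP.
by rewrite oner_eq0.
Qed.

End FreeModule.

Record submodule (k : comNzRingType) (V : lmodType k) := Submodule {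
  submodule_mem :> V -> Prop;
  submodule0 : submodule_mem 0;
  submoduleP : forall a x y,
    submodule_mem x -> submodule_mem y -> submodule_mem (a *: x + y) }.

Section Quotient.
Variables (k : comNzRingType) (V : lmodType k) (S : submodule V).

Definition submodule_pred : {pred V} := fun x => `[< S x >].

Lemma submodule_predP x : reflect (S x) (x \in submodule_pred).
Proof. exact: asboolP. Qed.

Lemma submodule_zmod_closed : zmod_closed submodule_pred.
Proof.
split=> [|x y /submodule_predP Sx /submodule_predP Sy]; apply/submodule_predP.
  exact: submodule0.
by have := submoduleP (-1) Sy Sx; rewrite scaleN1r addrC.
Qed.

HB.instance Definition _ :=
  GRing.isZmodClosed.Build V submodule_pred submodule_zmod_closed.

Definition quo : Type := Quotient.quot submodule_pred.
HB.instance Definition _ := GRing.Zmodule.on quo.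

Definition qpi (x : V) : quo := \pi_(Quotient.quot submodule_pred) x.

Lemma qpi_eq x y : (qpi x = qpi y) <-> S (x - y).
Proof.
rewrite /qpi; split=> [/eqP|Sxy]; last first.
  by apply/eqP; rewrite -Quotient.idealrBE; apply/submodule_predP.
by rewrite -Quotient.idealrBE => /submodule_predP.
Qed.

Lemma qpiD : {morph qpi : x y / x + y}.
Proof. exact: (@Quotient.pi_add V submodule_pred). Qed.

Definition qrepr (q : quo) : V := repr (q : Quotient.quot submodule_pred).

Lemma qreprK q : qpi (qrepr q) = q.
Proof. exact: reprK. Qed.

Lemma submoduleZ a x : S x -> S (a *: x).
Proof. by move=> Sx; rewrite -[_ *: _]addr0; apply: submoduleP => //; apply: submodule0. Qed.

Definition quo_scale (a : k) (q : quo) : quo := qpi (a *: qrepr q).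

Lemma quo_scaleE a x : quo_scale a (qpi x) = qpi (a *: x).
Proof.
apply/qpi_eq; rewrite -scalerBr; apply: submoduleZ; apply/qpi_eq.
exact: qreprK.
Qed.

Lemma quo_scaleA a b q : quo_scale a (quo_scale b q) = quo_scale (a * b) q.
Proof. by rewrite -[q]qreprK !quo_scaleE scalerA. Qed.

Lemma quo_scale1 : left_id 1 quo_scale.
Proof. by move=> q; rewrite -[q]qreprK quo_scaleE scale1r. Qed.

Lemma quo_scaleDr : right_distributive quo_scale +%R.
Proof.
move=> a p q; rewrite -[p]qreprK -[q]qreprK -qpiD !quo_scaleE -qpiD.
by rewrite scalerDr.
Qed.

Lemma quo_scaleDl q : {morph quo_scale^~ q : a b / a + b}.
Proof. by move=> a b; rewrite -[q]qreprK !quo_scaleE -qpiD scalerDl. Qed.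

HB.instance Definition _ := GRing.Zmodule_isLmodule.Build k quo
  quo_scaleA quo_scale1 quo_scaleDr quo_scaleDl.

Lemma qpi_linear : linear qpi.
Proof. by move=> a x y; rewrite qpiD -quo_scaleE. Qed.

Lemma qpi_eq0 x : (qpi x = 0) <-> S x.
Proof. by rewrite -(linear_map0 qpi_linear) qpi_eq subr0. Qed.

(* Meaningful only when f is linear and vanishes on S (see qliftE). *)
Definition qlift (U : lmodType k) (f : V -> U) (q : quo) : U := f (qrepr q).

Lemma qliftE (U : lmodType k) (f : V -> U) : linear f ->
  (forall x, S x -> f x = 0) -> forall x, qlift f (qpi x) = f x.
Proof.
move=> lf fS x; apply/eqP; rewrite -subr_eq0 -(linear_mapB lf).
by apply/eqP/fS/qpi_eq; exact: qreprK.
Qed.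

Lemma qlift_linear (U : lmodType k) (f : V -> U) : linear f ->
  (forall x, S x -> f x = 0) -> linear (qlift f).
Proof.
move=> lf fS a p q; rewrite -[p]qreprK -[q]qreprK -qpi_linear.
by rewrite !qliftE //; exact: lf.
Qed.

End Quotient.

Arguments qpi {k V} S x.
Arguments qlift {k V} S {U} f q.

(* The carrier is a k-module; the axioms say that lact is k-bilinear, so this
   is a B-module whose underlying k-structure is the one given. *)
Record leftModule (k : comNzRingType) (B : algType k) := LeftModule {
  left_car :> lmodType k;
  lact : B -> left_car -> left_car;
  lact_linearr : forall b, linear (lact b);
  lact_linearl : forall w, linear (fun b => lact b w);
  lact1 : forall w, lact 1 w = w;
  lactM : forall a b w, lact (a * b) w = lact a (lact b w) }.

Record rightModule (k : comNzRingType) (B : algType k) := RightModule {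
  right_car :> lmodType k;
  ract : right_car -> B -> right_car;
  ract_linearl : forall b, linear (fun w => ract w b);
  ract_linearr : forall w, linear (ract w);
  ract1 : forall w, ract w 1 = w;
  ractM : forall a b w, ract w (a * b) = ract (ract w a) b }.

Record bimodule (k : comNzRingType) (C B : algType k) := Bimodule {
  bi_left :> leftModule C;
  bact : bi_left -> B -> bi_left;
  bact_linearl : forall b, linear (fun w => bact w b);
  bact_linearr : forall w, linear (bact w);
  bact1 : forall w, bact w 1 = w;
  bactM : forall a b w, bact w (a * b) = bact (bact w a) b;
  bact_lact : forall c w b, lact c (bact w b) = bact (lact c w) b }.

Definition bi_right (k : comNzRingType) (C B : algType k) (W : bimodule C B) : rightModule B :=
  RightModule (@bact_linearl _ _ _ W) (@bact_linearr _ _ _ W)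
    (@bact1 _ _ _ W) (@bactM _ _ _ W).

Definition simple_module (k : comNzRingType) (B : algType k) (V : leftModule B) : Prop :=
  (exists v : V, v <> 0) /\
  forall S : submodule V, (forall b v, S v -> S (lact b v)) ->
    (forall v, S v -> v = 0) \/ (forall v, S v).

Section Tensor.
Variables (k : comNzRingType) (B : algType k).
Variables (M : rightModule B) (N : leftModule B).

(* M (x)_B N is built as a k-module: {freeg (M * N) / k} is the free k-module
   on the set M * N, and tensor_rel is the submodule of it spanned by the
   bilinearity and B-balancing relations. *)
Definition pair_gen (m : M) (n : N) : {freeg (M * N)%type / k} := << (m, n) >>.

Inductive tensor_rel : {freeg (M * N)%type / k} -> Prop :=
| TensorRel0 : tensor_rel 0
| TensorRelP a x y : tensor_rel x -> tensor_rel y -> tensor_rel (a *: x + y)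
| TensorRel_linearl a m m' n :
    tensor_rel (pair_gen (a *: m + m') n - (a *: pair_gen m n + pair_gen m' n))
| TensorRel_linearr a m n n' :
    tensor_rel (pair_gen m (a *: n + n') - (a *: pair_gen m n + pair_gen m n'))
| TensorRel_balanced m b n :
    tensor_rel (pair_gen (ract m b) n - pair_gen m (lact b n)).

Definition tensor_submodule := Submodule TensorRel0 TensorRelP.

Definition tensor : lmodType k := quo tensor_submodule.

Definition tens (m : M) (n : N) : tensor := qpi tensor_submodule (pair_gen m n).

Lemma tens_linearl n : linear (fun m => tens m n).
Proof.
move=> a m m'; rewrite /tens -qpi_linear; apply/qpi_eq.
exact: TensorRel_linearl.
Qed.

Lemma tens_linearr m : linear (tens m).
Proof.
move=> a n n'; rewrite /tens -qpi_linear; apply/qpi_eq.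
exact: TensorRel_linearr.
Qed.

Lemma tens_balanced m b n : tens (ract m b) n = tens m (lact b n).
Proof. by apply/qpi_eq; exact: TensorRel_balanced. Qed.

Record balanced (U : lmodType k) (f : M -> N -> U) : Prop := Balanced {
  balanced_linearl : forall n, linear (fun m => f m n);
  balanced_linearr : forall m, linear (f m);
  balanced_act : forall m b n, f (ract m b) n = f m (lact b n) }.

Lemma fglift_linear (K : choiceType) (U : lmodType k) (f : K -> U) :
  linear (fglift f : {freeg K / k} -> U).
Proof.
have fD := @lift_is_additive k K U f.
have f0 : fglift f 0 = 0 by have := fD 0 0; rewrite !subrr.
have fN y : fglift f (- y) = - fglift f y.
  by have := fD 0 y; rewrite f0 !sub0r.
have fA : {morph fglift f : x y / x + y}.
  by move=> x y; rewrite -{1}[y]opprK fD fN opprK.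
have fS (s : seq K) (c : K -> k) : fglift f (\sum_(z <- s) << c z *g z >>) =
    \sum_(z <- s) c z *: f z.
  rewrite (big_morph _ fA f0); apply: eq_bigr => z _; exact: liftU.
move=> a x y; rewrite fA; congr (_ + _).
have -> : fglift f (a *: x) = \sum_(z <- dom x) (a * coeff z x) *: f z.
  by rewrite -fS.
have -> : fglift f x = \sum_(z <- dom x) coeff z x *: f z.
  by rewrite -fS freeg_sumE.
rewrite scaler_sumr.
by apply: eq_bigr => z _; rewrite scalerA.
Qed.

(* Meaningful only when f is balanced (see tliftE). *)
Definition tlift (U : lmodType k) (f : M -> N -> U) (t : tensor) : U :=
  qlift tensor_submodule (fglift (fun p => f p.1 p.2)) t.

Section Lift.
Variables (U : lmodType k) (f : M -> N -> U) (bf : balanced f).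

Local Lemma fglift_gen m n : fglift (fun p => f p.1 p.2) (pair_gen m n) = f m n.
Proof. by rewrite /pair_gen liftU scale1r. Qed.

Local Lemma fglift_rel x : tensor_rel x -> fglift (fun p => f p.1 p.2) x = 0.
Proof.
have lf := fglift_linear (fun p => f p.1 p.2).
elim=> [|a {}x y _ x0 _ y0|a m m' n|a m n n'|m b n].
- exact: linear_map0.
- by rewrite lf x0 y0 scaler0 addr0.
- by rewrite (linear_mapB lf) lf !fglift_gen (balanced_linearl bf) subrr.
- by rewrite (linear_mapB lf) lf !fglift_gen (balanced_linearr bf) subrr.
- by rewrite (linear_mapB lf) !fglift_gen (balanced_act bf) subrr.
Qed.

Lemma tliftE m n : tlift f (tens m n) = f m n.
Proof.
rewrite -[RHS]fglift_gen; apply: qliftE; first exact: fglift_linear.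
exact: fglift_rel.
Qed.

Lemma tlift_linear : linear (tlift f).
Proof. by apply: qlift_linear; [exact: fglift_linear|exact: fglift_rel]. Qed.

End Lift.

Lemma tensor_sum (t : tensor) : exists s : seq (M * N),
  t = \sum_(p <- s) tens p.1 p.2.
Proof.
rewrite -[t]qreprK; move: (qrepr t) => x.
exists [seq (coeff z x *: z.1, z.2) | z <- dom x].
rewrite big_map.
transitivity (\sum_(z <- dom x) qpi tensor_submodule << coeff z x *g z >>).
  by rewrite -{1}[x]freeg_sumE; exact: (linear_map_sum (qpi_linear _)).
apply: eq_bigr => -[m n] _ /=; rewrite (linear_mapZ (tens_linearl n)).
rewrite /tens -(linear_mapZ (qpi_linear _)) /pair_gen; congr (qpi _ _).
by apply/eqP/freeg_eqP => z; rewrite coeffZ !coeffU mul1r.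
Qed.

Lemma tensor_ext (U : lmodType k) (f g : tensor -> U) : linear f -> linear g ->
  (forall m n, f (tens m n) = g (tens m n)) -> forall t, f t = g t.
Proof.
move=> lf lg fg t; have [s ->] := tensor_sum t.
by rewrite !linear_map_sum //; apply: eq_bigr.
Qed.

End Tensor.

Section TensorLeft.
Variables (k : comNzRingType) (C B : algType k).
Variables (W : bimodule C B) (V : leftModule B).
Local Notation T := (tensor (bi_right W) V).

Definition tensor_lact (c : C) : T -> T :=
  tlift (fun (w : bi_right W) v => tens (lact c (w : W) : bi_right W) v).

Lemma tensor_lact_balanced c :
  balanced (fun (w : bi_right W) (v : V) => tens (lact c (w : W) : bi_right W) v).
Proof.
split=> [v|w|w b v].
- exact: (@linear_comp _ W (bi_right W) T _ _
    (@tens_linearl _ _ (bi_right W) V v) (lact_linearr c)).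
- exact: tens_linearr.
- by rewrite -tens_balanced /= -bact_lact.
Qed.

Lemma tensor_lactE c (w : bi_right W) (v : V) :
  tensor_lact c (tens w v) = tens (lact c (w : W) : bi_right W) v.
Proof. exact: (tliftE (tensor_lact_balanced c)). Qed.

Lemma tensor_lact_linearr c : linear (tensor_lact c).
Proof. exact: (tlift_linear (tensor_lact_balanced c)). Qed.

Lemma tensor_lact_linearl t : linear (fun c => tensor_lact c t).
Proof.
move=> a c c'; move: t; apply: tensor_ext => [||w v].
- exact: tensor_lact_linearr.
- by apply: linear_lincomb; exact: tensor_lact_linearr.
- by rewrite !tensor_lactE lact_linearl tens_linearl.
Qed.

Lemma tensor_lact1 t : tensor_lact 1 t = t.
Proof.
move: t; apply: tensor_ext => [||w v]; first exact: tensor_lact_linearr.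
- exact: linear_id.
- by rewrite tensor_lactE lact1.
Qed.

Lemma tensor_lactM c c' t :
  tensor_lact (c * c') t = tensor_lact c (tensor_lact c' t).
Proof.
move: t; apply: tensor_ext => [||w v]; first exact: tensor_lact_linearr.
- by apply: linear_comp; exact: tensor_lact_linearr.
- by rewrite !tensor_lactE lactM.
Qed.

Definition tensor_left : leftModule C :=
  LeftModule tensor_lact_linearr tensor_lact_linearl tensor_lact1 tensor_lactM.

End TensorLeft.

Definition rcomp (Z Y X : finType) (S : {set Z * Y}) (Q : {set Y * X}) :
    {set Z * X} :=
  [set p | [exists y, ((p.1, y) \in S) && ((y, p.2) \in Q)]].

Definition diagrel (E : finType) : {set E * E} := [set (e, e) | e : E].

Definition permrel (E : finType) (s : {perm E}) : {set E * E} :=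
  [set (s e, e) | e : E].

Section RelTheory.

Lemma rcompP (Z Y X : finType) (S : {set Z * Y}) (Q : {set Y * X}) z x :
  reflect (exists2 y, (z, y) \in S & (y, x) \in Q) ((z, x) \in rcomp S Q).
Proof.
rewrite inE /=; apply: (iffP existsP) => [[y /andP[]]|[y Sy Qy]]; exists y => //.
by rewrite Sy.
Qed.

Lemma diagrelE (E : finType) (x y : E) : ((x, y) \in diagrel E) = (x == y).
Proof.
by apply/imsetP/eqP => [[e _ [-> ->]]|->] //; exists y.
Qed.

Lemma permrelE (E : finType) (s : {perm E}) (x y : E) :
  ((x, y) \in permrel s) = (x == s y).
Proof.
by apply/imsetP/eqP => [[e _ [-> ->]]|->] //; exists y.
Qed.

Lemma rcompA (T Z Y X : finType) (P : {set T * Z}) (S : {set Z * Y})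
  (Q : {set Y * X}) : rcomp P (rcomp S Q) = rcomp (rcomp P S) Q.
Proof.
apply/setP => -[t x]; apply/rcompP/rcompP.
  by move=> [z Pz /rcompP[y Sy Qy]]; exists y => //; apply/rcompP; exists z.
by move=> [y /rcompP[z Pz Sz] Qy]; exists z => //; apply/rcompP; exists y.
Qed.

Lemma rcomp1l (Y X : finType) (Q : {set Y * X}) : rcomp (diagrel Y) Q = Q.
Proof.
apply/setP => -[y x]; apply/rcompP/idP => [[z]|Qyx].
  by rewrite diagrelE => /eqP ->.
by exists y; rewrite ?diagrelE.
Qed.

Lemma rcomp1r (Y X : finType) (Q : {set Y * X}) : rcomp Q (diagrel X) = Q.
Proof.
apply/setP => -[y x]; apply/rcompP/idP => [[z Qz]|Qyx].
  by rewrite diagrelE => /eqP <-.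
by exists x; rewrite ?diagrelE.
Qed.

End RelTheory.

(* corr k Y X is kC(Y, X): the morphisms from X to Y, in this order. *)
Notation corr k Y X := (fmod k {set Y * X}).

Section CorrComp.
Variable k : comNzRingType.

Definition ccomp (Z Y X : finType) : corr k Z Y -> corr k Y X -> corr k Z X :=
  fbil (fun S Q => basis k (rcomp S Q)).

Lemma ccomp_basis (Z Y X : finType) (S : {set Z * Y}) (Q : {set Y * X}) :
  ccomp (basis k S) (basis k Q) = basis k (rcomp S Q).
Proof. exact: fbil_basis. Qed.

Lemma ccomp_linearl (Z Y X : finType) (b : corr k Y X) :
  linear (fun a : corr k Z Y => ccomp a b).
Proof. exact: fbil_linearl. Qed.

Lemma ccomp_linearr (Z Y X : finType) (a : corr k Z Y) :
  linear (fun b : corr k Y X => ccomp a b).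
Proof. exact: fbil_linearr. Qed.

Lemma ccompA (T Z Y X : finType) (a : corr k T Z) (b : corr k Z Y)
  (c : corr k Y X) : ccomp a (ccomp b c) = ccomp (ccomp a b) c.
Proof.
move: a; apply: fmod_ext => [||P].
- exact: ccomp_linearl.
- exact: (linear_comp (@ccomp_linearl _ _ _ c) (@ccomp_linearl _ _ _ b)).
move: b; apply: fmod_ext => [||S].
- exact: (linear_comp (@ccomp_linearr _ _ _ _) (@ccomp_linearl _ _ _ c)).
- exact: (linear_comp (@ccomp_linearl _ _ _ c) (@ccomp_linearr _ _ _ _)).
move: c; apply: fmod_ext => [||Q].
- exact: (linear_comp (@ccomp_linearr _ _ _ _) (@ccomp_linearr _ _ _ _)).
- exact: ccomp_linearr.
by rewrite !ccomp_basis rcompA.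
Qed.

Lemma ccomp1l (Y X : finType) (b : corr k Y X) : ccomp (basis k (diagrel Y)) b = b.
Proof.
move: b; apply: fmod_ext => [||Q]; first exact: ccomp_linearr.
- exact: linear_id.
- by rewrite ccomp_basis rcomp1l.
Qed.

Lemma ccomp1r (Y X : finType) (b : corr k Y X) : ccomp b (basis k (diagrel X)) = b.
Proof.
move: b; apply: fmod_ext => [||Q]; first exact: ccomp_linearl.
- exact: linear_id.
- by rewrite ccomp_basis rcomp1r.
Qed.

End CorrComp.

Definition corr_alg (k : comNzRingType) (E : finType) : Type := corr k E E.

Section CorrAlg.
Variables (k : comNzRingType) (E : finType).

HB.instance Definition _ := GRing.Lmodule.copy (corr_alg k E) (corr k E E).

Lemma corr_mulDl : left_distributive (@ccomp k E E E) +%R.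
Proof. by move=> a b c; exact: (linear_mapD (@ccomp_linearl _ _ _ _ c)). Qed.

Lemma corr_mulDr : right_distributive (@ccomp k E E E) +%R.
Proof. by move=> a b c; exact: (linear_mapD (@ccomp_linearr _ _ _ _ a)). Qed.

HB.instance Definition _ := GRing.Zmodule_isNzRing.Build (corr_alg k E)
  (@ccompA k E E E E) (@ccomp1l k E E) (@ccomp1r k E E)
  corr_mulDl corr_mulDr (basis_neq0 k (diagrel E)).

Lemma corr_scaleAl (c : k) (a b : corr_alg k E) : c *: (a * b) = (c *: a) * b.
Proof. exact: (esym (linear_mapZ (@ccomp_linearl _ _ _ _ b) c a)). Qed.

HB.instance Definition _ :=
  GRing.Lmodule_isLalgebra.Build k (corr_alg k E) corr_scaleAl.

Lemma corr_scaleAr (c : k) (a b : corr_alg k E) : c *: (a * b) = a * (c *: b).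
Proof. exact: (esym (linear_mapZ (@ccomp_linearr _ _ _ _ a) c b)). Qed.

HB.instance Definition _ :=
  GRing.Lalgebra_isAlgebra.Build k (corr_alg k E) corr_scaleAr.

End CorrAlg.

Definition corr_right (k : comNzRingType) (X E : finType) :
    rightModule (corr_alg k E) :=
  @RightModule k (corr_alg k E) (corr k X E) (@ccomp k X E E)
    (fun b => @ccomp_linearl k X E E b) (@ccomp_linearr k X E E)
    (@ccomp1r k X E) (fun a b w => ccompA w a b).

Record corrFunctor (k : comNzRingType) := CorrFunctor {
  fobj :> finType -> lmodType k;
  fmap : forall X Y : finType, corr k Y X -> fobj X -> fobj Y;
  fmap_linearr : forall (X Y : finType) (phi : corr k Y X), linear (fmap phi);
  fmap_linearl : forall (X Y : finType) (x : fobj X),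
    linear (fun phi : corr k Y X => fmap phi x);
  fmap_id : forall (X : finType) (x : fobj X), fmap (basis k (diagrel X)) x = x;
  fmap_comp : forall (X Y Z : finType) (psi : corr k Z Y) (phi : corr k Y X) (x : fobj X),
    fmap (ccomp psi phi) x = fmap psi (fmap phi x) }.

Record corrHom (k : comNzRingType) (F G : corrFunctor k) := CorrHom {
  hcomp :> forall X : finType, F X -> G X;
  hcomp_linear : forall X : finType, linear (@hcomp X);
  hcomp_natural : forall (X Y : finType) (phi : corr k Y X) (x : F X),
    hcomp (fmap phi x) = fmap phi (hcomp x) }.

Definition is_corr_iso (k : comNzRingType) (F G : corrFunctor k) (f : corrHom F G) : Prop :=
  exists g : corrHom G F,
    (forall X : finType, cancel (f X) (g X)) /\ (forall X : finType, cancel (g X) (f X)).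

Record corrFunctorR (k : comNzRingType) (B : algType k) := CorrFunctorR {
  funR :> corrFunctor k;
  fract : forall X : finType, funR X -> B -> funR X;
  fract_linearl : forall (X : finType) b, linear (fun x : funR X => fract x b);
  fract_linearr : forall (X : finType) (x : funR X), linear (fract x);
  fract1 : forall (X : finType) (x : funR X), fract x 1 = x;
  fractM : forall (X : finType) a b (x : funR X),
    fract x (a * b) = fract (fract x a) b;
  fract_fmap : forall (X Y : finType) (phi : corr k Y X) (x : funR X) b,
    fmap phi (fract x b) = fract (fmap phi x) b }.

Definition funR_right (k : comNzRingType) (B : algType k) (F : corrFunctorR B) (X : finType) :
    rightModule B :=
  @RightModule k B (F X) (@fract _ _ F X) (@fract_linearl _ _ F X)
    (@fract_linearr _ _ F X) (@fract1 _ _ F X) (@fractM _ _ F X).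

Section FunctorTensor.
Variables (k : comNzRingType) (B : algType k).
Variables (F : corrFunctorR B) (V : leftModule B).

Definition ftensor_obj (X : finType) : lmodType k := tensor (funR_right F X) V.

Definition ftensor_map (X Y : finType) (phi : corr k Y X) :
    ftensor_obj X -> ftensor_obj Y :=
  tlift (fun (x : funR_right F X) v =>
    tens (fmap phi (x : F X) : funR_right F Y) v).

Lemma ftensor_balanced (X Y : finType) (phi : corr k Y X) :
  balanced (fun (x : funR_right F X) (v : V) =>
    tens (fmap phi (x : F X) : funR_right F Y) v).
Proof.
split=> [v|x|x b v].
- exact: (@linear_comp _ (F X) (funR_right F Y) (ftensor_obj Y) _ _
    (@tens_linearl _ _ (funR_right F Y) V v) (fmap_linearr phi)).
- exact: tens_linearr.
- by rewrite -tens_balanced /= -fract_fmap.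
Qed.

Lemma ftensor_mapE (X Y : finType) (phi : corr k Y X) (x : F X) (v : V) :
  ftensor_map phi (tens (x : funR_right F X) v) =
  tens (fmap phi x : funR_right F Y) v.
Proof. exact: (tliftE (ftensor_balanced phi)). Qed.

Lemma ftensor_map_linearr (X Y : finType) (phi : corr k Y X) :
  linear (ftensor_map phi).
Proof. exact: (tlift_linear (ftensor_balanced phi)). Qed.

Lemma ftensor_map_linearl (X Y : finType) (t : ftensor_obj X) :
  linear (fun phi : corr k Y X => ftensor_map phi t).
Proof.
move=> a c c'; move: t; apply: tensor_ext => [||x v].
- exact: ftensor_map_linearr.
- by apply: linear_lincomb; exact: ftensor_map_linearr.
- by rewrite !ftensor_mapE fmap_linearl tens_linearl.
Qed.

Lemma ftensor_map_id (X : finType) (t : ftensor_obj X) :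
  ftensor_map (basis k (diagrel X)) t = t.
Proof.
move: t; apply: tensor_ext => [||x v]; first exact: ftensor_map_linearr.
- exact: linear_id.
- by rewrite ftensor_mapE fmap_id.
Qed.

Lemma ftensor_map_comp (X Y Z : finType) (psi : corr k Z Y) (phi : corr k Y X)
  (t : ftensor_obj X) :
  ftensor_map (ccomp psi phi) t = ftensor_map psi (ftensor_map phi t).
Proof.
move: t; apply: tensor_ext => [||x v]; first exact: ftensor_map_linearr.
- by apply: linear_comp; exact: ftensor_map_linearr.
- by rewrite !ftensor_mapE fmap_comp.
Qed.

Definition ftensor : corrFunctor k :=
  CorrFunctor ftensor_map_linearr ftensor_map_linearl ftensor_map_id
    ftensor_map_comp.

End FunctorTensor.

Section LJ.
Variables (k : comNzRingType) (E : finType) (W : leftModule (corr_alg k E)).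

Definition L_obj (X : finType) : lmodType k := tensor (corr_right k X E) W.

Definition L_tens (X : finType) (phi : corr k X E) (w : W) : L_obj X :=
  tens (phi : corr_right k X E) w.

Definition L_map (X Y : finType) (psi : corr k Y X) : L_obj X -> L_obj Y :=
  tlift (fun (phi : corr_right k X E) w => L_tens (ccomp psi phi) w).

Lemma L_balanced (X Y : finType) (psi : corr k Y X) :
  balanced (fun (phi : corr_right k X E) w => L_tens (ccomp psi phi) w).
Proof.
split=> [w|phi|phi b w].
- exact: (linear_comp (@tens_linearl _ _ (corr_right k Y E) W w)
    (@ccomp_linearr _ _ _ _ psi)).
- exact: tens_linearr.
- by rewrite /L_tens -tens_balanced /= ccompA.
Qed.

Lemma L_mapE (X Y : finType) (psi : corr k Y X) phi w :
  L_map psi (L_tens phi w) = L_tens (ccomp psi phi) w.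
Proof. exact: (tliftE (L_balanced psi)). Qed.

Lemma L_map_linearr (X Y : finType) (psi : corr k Y X) : linear (L_map psi).
Proof. exact: (tlift_linear (L_balanced psi)). Qed.

Lemma L_tens_linearl (X : finType) w : linear (fun phi : corr k X E => L_tens phi w).
Proof. exact: (@tens_linearl _ _ (corr_right k X E) W w). Qed.

Lemma L_map_linearl (X Y : finType) (t : L_obj X) :
  linear (fun psi : corr k Y X => L_map psi t).
Proof.
move=> a c c'; move: t; apply: tensor_ext => [||phi w].
- exact: L_map_linearr.
- by apply: linear_lincomb; exact: L_map_linearr.
- by rewrite -/(L_tens phi w) !L_mapE ccomp_linearl L_tens_linearl.
Qed.

Lemma L_map_id (X : finType) (t : L_obj X) : L_map (basis k (diagrel X)) t = t.
Proof.
move: t; apply: tensor_ext => [||phi w]; first exact: L_map_linearr.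
- exact: linear_id.
- by rewrite -/(L_tens phi w) L_mapE ccomp1l.
Qed.

Lemma L_map_comp (X Y Z : finType) (psi : corr k Z Y) (phi : corr k Y X)
  (t : L_obj X) : L_map (ccomp psi phi) t = L_map psi (L_map phi t).
Proof.
move: t; apply: tensor_ext => [||c w]; first exact: L_map_linearr.
- by apply: linear_comp; exact: L_map_linearr.
- by rewrite -/(L_tens c w) !L_mapE ccompA.
Qed.

Definition L_functor : corrFunctor k :=
  CorrFunctor L_map_linearr L_map_linearl L_map_id L_map_comp.

Definition J_mem (X : finType) (t : L_obj X) : Prop :=
  exists s : seq (corr k X E * W),
    t = \sum_(p <- s) L_tens p.1 p.2 /\
    forall rho : corr k E X,
      \sum_(p <- s) lact (ccomp rho p.1 : corr_alg k E) p.2 = 0.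

Lemma J_mem0 (X : finType) : J_mem (0 : L_obj X).
Proof. by exists [::]; split=> [|rho]; rewrite big_nil. Qed.

Lemma J_memP (X : finType) a (x y : L_obj X) :
  J_mem x -> J_mem y -> J_mem (a *: x + y).
Proof.
move=> [s [-> s0]] [s' [-> s'0]].
exists ([seq (a *: p.1, p.2) | p <- s] ++ s'); split=> [|rho].
  rewrite big_cat big_map scaler_sumr; congr (_ + _).
  by apply: eq_bigr => p _; rewrite /= (linear_mapZ (L_tens_linearl _)).
rewrite big_cat big_map /= s'0 addr0.
transitivity (a *: \sum_(p <- s) lact (ccomp rho p.1 : corr_alg k E) p.2);
  last by rewrite s0 scaler0.
rewrite scaler_sumr; apply: eq_bigr => p _ /=.
rewrite (linear_mapZ (@ccomp_linearr _ _ _ _ rho)).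
exact: (linear_mapZ (lact_linearl _)).
Qed.

Definition J_sub (X : finType) : submodule (L_obj X) :=
  Submodule (@J_mem0 X) (@J_memP X).

Lemma J_map (X Y : finType) (psi : corr k Y X) t :
  J_sub X t -> J_sub Y (L_map psi t).
Proof.
move=> [s [-> s0]]; exists [seq (ccomp psi p.1, p.2) | p <- s]; split=> [|rho].
  rewrite big_map (linear_map_sum (L_map_linearr psi)).
  by apply: eq_bigr => p _; rewrite L_mapE.
by rewrite big_map -[RHS](s0 (ccomp rho psi)); apply: eq_bigr => p _; rewrite ccompA.
Qed.

(* (L_{E,W} / J_{E,W})(X) *)
Definition S_obj (X : finType) : lmodType k := quo (J_sub X).

Definition S_pi (X : finType) (t : L_obj X) : S_obj X := qpi (J_sub X) t.

Definition S_map (X Y : finType) (psi : corr k Y X) : S_obj X -> S_obj Y :=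
  qlift (J_sub X) (fun t => S_pi (L_map psi t)).

Lemma S_pi_linear (X : finType) : linear (@S_pi X).
Proof. exact: qpi_linear. Qed.

Lemma S_piL_linear (X Y : finType) (psi : corr k Y X) :
  linear (fun t => S_pi (L_map psi t)).
Proof. exact: (linear_comp (@S_pi_linear Y) (L_map_linearr psi)). Qed.

Lemma S_piL0 (X Y : finType) (psi : corr k Y X) t :
  J_sub X t -> S_pi (L_map psi t) = 0.
Proof. by move=> Jt; apply/qpi_eq0; apply: J_map. Qed.

Lemma S_mapE (X Y : finType) (psi : corr k Y X) t :
  S_map psi (S_pi t) = S_pi (L_map psi t).
Proof.
rewrite /S_map [in LHS]/S_pi qliftE //.
  exact: S_piL_linear.
exact: S_piL0.
Qed.

Lemma S_map_linearr (X Y : finType) (psi : corr k Y X) : linear (S_map psi).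
Proof. by apply: qlift_linear; [exact: S_piL_linear|exact: S_piL0]. Qed.

Lemma S_piP (X : finType) (q : S_obj X) : exists t, q = S_pi t.
Proof. by exists (qrepr q); rewrite /S_pi qreprK. Qed.

Lemma S_map_linearl (X Y : finType) (q : S_obj X) :
  linear (fun psi : corr k Y X => S_map psi q).
Proof.
move=> a c c'; have [t ->] := S_piP q.
by rewrite !S_mapE L_map_linearl S_pi_linear.
Qed.

Lemma S_map_id (X : finType) (q : S_obj X) : S_map (basis k (diagrel X)) q = q.
Proof. by have [t ->] := S_piP q; rewrite S_mapE L_map_id. Qed.

Lemma S_map_comp (X Y Z : finType) (psi : corr k Z Y) (phi : corr k Y X)
  (q : S_obj X) : S_map (ccomp psi phi) q = S_map psi (S_map phi q).
Proof. by have [t ->] := S_piP q; rewrite !S_mapE L_map_comp. Qed.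

Definition S_functor : corrFunctor k :=
  CorrFunctor S_map_linearr S_map_linearl S_map_id S_map_comp.

Lemma S_ext (X : finType) (U : lmodType k) (f g : S_obj X -> U) :
  linear f -> linear g ->
  (forall phi w, f (S_pi (L_tens phi w)) = g (S_pi (L_tens phi w))) ->
  forall q, f q = g q.
Proof.
move=> lf lg fg q; have [t ->] := S_piP q; move: t; apply: tensor_ext => //.
- exact: (linear_comp lf (@S_pi_linear X)).
- exact: (linear_comp lg (@S_pi_linear X)).
Qed.

End LJ.

Section BimoduleS.
Variables (k : comNzRingType) (E : finType) (B : algType k).
Variable W : bimodule (corr_alg k E) B.

Definition L_ract (X : finType) (t : L_obj W X) (b : B) : L_obj W X :=
  tlift (fun (phi : corr_right k X E) (w : W) => L_tens phi (bact w b)) t.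

Lemma L_ract_balanced (X : finType) b :
  balanced (fun (phi : corr_right k X E) (w : W) => L_tens phi (bact w b)).
Proof.
split=> [w|phi|phi c w]; first exact: L_tens_linearl.
- exact: (linear_comp (@tens_linearr _ _ (corr_right k X E) W phi)
    (@bact_linearl _ _ _ W b)).
- by rewrite /L_tens tens_balanced bact_lact.
Qed.

Lemma L_ractE (X : finType) (phi : corr k X E) (w : W) b :
  L_ract (L_tens phi w) b = L_tens phi (bact w b).
Proof. exact: (tliftE (L_ract_balanced X b)). Qed.

Lemma L_ract_linear (X : finType) b : linear (fun t : L_obj W X => L_ract t b).
Proof. exact: (tlift_linear (L_ract_balanced X b)). Qed.

Lemma J_ract (X : finType) (t : L_obj W X) b : J_sub W X t -> J_sub W X (L_ract t b).
Proof.
move=> [s [-> s0]]; exists [seq (p.1, bact p.2 b) | p <- s]; split=> [|rho].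
  rewrite big_map (linear_map_sum (@L_ract_linear X b)).
  by apply: eq_bigr => p _; rewrite L_ractE.
rewrite big_map; transitivity
  (bact (\sum_(p <- s) lact (ccomp rho p.1 : corr_alg k E) p.2 : W) b);
  last by rewrite s0; exact: (linear_map0 (bact_linearl b)).
rewrite (linear_map_sum (@bact_linearl _ _ _ W b)).
by apply: eq_bigr => p _; rewrite bact_lact.
Qed.

Definition S_ract (X : finType) (q : S_obj W X) (b : B) : S_obj W X :=
  qlift (J_sub W X) (fun t => S_pi (L_ract t b)) q.

Lemma S_piR_linear (X : finType) b : linear (fun t : L_obj W X => S_pi (L_ract t b)).
Proof. exact: (linear_comp (@S_pi_linear _ _ _ X) (@L_ract_linear X b)). Qed.

Lemma S_piR0 (X : finType) b (t : L_obj W X) :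
  J_sub W X t -> S_pi (L_ract t b) = 0.
Proof. by move=> Jt; apply/qpi_eq0; apply: J_ract. Qed.

Lemma S_ract_linearl (X : finType) b : linear (fun q : S_obj W X => S_ract q b).
Proof. exact: (qlift_linear (@S_piR_linear X b) (@S_piR0 X b)). Qed.

Lemma S_ractE (X : finType) (phi : corr k X E) (w : W) b :
  S_ract (S_pi (L_tens phi w)) b = S_pi (L_tens phi (bact w b)).
Proof.
rewrite /S_ract [in LHS]/S_pi qliftE ?L_ractE //.
  exact: S_piR_linear.
exact: S_piR0.
Qed.

Lemma S_pi_linearr (X : finType) (phi : corr k X E) :
  linear (fun w : W => S_pi (L_tens phi w)).
Proof.
exact: (linear_comp (@S_pi_linear _ _ _ X)
  (@tens_linearr _ _ (corr_right k X E) W phi)).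
Qed.

Lemma S_ract_linearr (X : finType) (q : S_obj W X) : linear (S_ract q).
Proof.
move=> a b c; move: q; apply: S_ext => [||phi w].
- exact: S_ract_linearl.
- by apply: linear_lincomb; exact: S_ract_linearl.
- by rewrite !S_ractE bact_linearr S_pi_linearr.
Qed.

Lemma S_ract1 (X : finType) (q : S_obj W X) : S_ract q 1 = q.
Proof.
move: q; apply: S_ext => [||phi w]; first exact: S_ract_linearl.
- exact: linear_id.
- by rewrite S_ractE bact1.
Qed.

Lemma S_ractM (X : finType) a b (q : S_obj W X) :
  S_ract q (a * b) = S_ract (S_ract q a) b.
Proof.
move: q; apply: S_ext => [||phi w]; first exact: S_ract_linearl.
- exact: (linear_comp (@S_ract_linearl X b) (@S_ract_linearl X a)).
- by rewrite !S_ractE bactM.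
Qed.

Lemma S_ract_map (X Y : finType) (psi : corr k Y X) (q : S_obj W X) b :
  S_map psi (S_ract q b) = S_ract (S_map psi q) b.
Proof.
move: q; apply: S_ext => [||phi w].
- exact: (linear_comp (@S_map_linearr _ _ _ _ _ psi) (@S_ract_linearl X b)).
- exact: (linear_comp (@S_ract_linearl Y b) (@S_map_linearr _ _ _ _ _ psi)).
- by rewrite S_ractE !S_mapE !L_mapE S_ractE.
Qed.

Definition S_functorR : corrFunctorR B :=
  @CorrFunctorR k B (S_functor W) S_ract S_ract_linearl S_ract_linearr
    S_ract1 S_ractM S_ract_map.

End BimoduleS.

Section Psi.
Variables (k : comNzRingType) (E : finType) (B : algType k).
Variables (W : bimodule (corr_alg k E) B) (V : leftModule B).

Local Notation WV := (tensor_left W V).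

Definition wtens (w : W) (v : V) : WV := tens (w : bi_right W) v.

Definition L_psi (X : finType) (v : V) : L_obj W X -> L_obj WV X :=
  tlift (fun (phi : corr_right k X E) (w : W) => L_tens phi (wtens w v)).

Definition S_psi (X : finType) (v : V) : S_obj W X -> S_obj WV X :=
  qlift (J_sub W X) (fun t => S_pi (L_psi v t)).

Definition Psi_fun (X : finType) :
    ftensor (S_functorR W) V X -> S_functor WV X :=
  tlift (fun (q : funR_right (S_functorR W) X) (v : V) => S_psi v q).

Lemma wtens_linearl v : linear (fun w => wtens w v).
Proof. exact: (@tens_linearl _ _ (bi_right W) V v). Qed.

Lemma wtens_linearr w : linear (wtens w).
Proof. exact: (@tens_linearr _ _ (bi_right W) V w). Qed.

Lemma lact_wtens (c : corr_alg k E) w v : lact c (wtens w v) = wtens (lact c w) v.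
Proof. exact: tensor_lactE. Qed.

Lemma L_tensr_linear (X : finType) (phi : corr k X E) :
  linear (fun w : WV => L_tens phi w).
Proof. exact: (@tens_linearr _ _ (corr_right k X E) WV phi). Qed.

Lemma L_psi_balanced (X : finType) (v : V) :
  balanced (fun (phi : corr_right k X E) (w : W) => L_tens phi (wtens w v)).
Proof.
split=> [w|phi|phi c w]; first exact: L_tens_linearl.
- exact: (linear_comp (@L_tensr_linear X phi) (@wtens_linearl v)).
- by rewrite /L_tens tens_balanced lact_wtens.
Qed.

Lemma L_psiE (X : finType) v (phi : corr k X E) w :
  L_psi v (L_tens phi w) = L_tens phi (wtens w v).
Proof. exact: (tliftE (L_psi_balanced X v)). Qed.

Lemma L_psi_linear (X : finType) v : linear (@L_psi X v).
Proof. exact: (tlift_linear (L_psi_balanced X v)). Qed.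

Lemma J_psi (X : finType) v (t : L_obj W X) :
  J_sub W X t -> J_sub WV X (L_psi v t).
Proof.
move=> [s [-> s0]]; exists [seq (p.1, wtens p.2 v) | p <- s]; split=> [|rho].
  rewrite big_map (linear_map_sum (@L_psi_linear X v)).
  by apply: eq_bigr => p _; rewrite L_psiE.
rewrite big_map; transitivity
  (wtens (\sum_(p <- s) lact (ccomp rho p.1 : corr_alg k E) p.2 : W) v);
  last by rewrite s0; exact: (linear_map0 (wtens_linearl v)).
rewrite (linear_map_sum (wtens_linearl v)).
by apply: eq_bigr => p _; rewrite lact_wtens.
Qed.

Lemma S_piP_linear (X : finType) v : linear (fun t : L_obj W X => S_pi (L_psi v t)).
Proof. exact: (linear_comp (@S_pi_linear _ _ _ X) (@L_psi_linear X v)). Qed.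

Lemma S_piP0 (X : finType) v (t : L_obj W X) :
  J_sub W X t -> S_pi (L_psi v t) = 0.
Proof. by move=> Jt; apply/qpi_eq0; apply: J_psi. Qed.

Lemma S_psi_linear (X : finType) v : linear (@S_psi X v).
Proof. exact: (qlift_linear (@S_piP_linear X v) (@S_piP0 X v)). Qed.

Lemma S_psiE (X : finType) v (phi : corr k X E) w :
  S_psi v (S_pi (L_tens phi w)) = S_pi (L_tens phi (wtens w v)).
Proof.
rewrite /S_psi [in LHS]/S_pi qliftE ?L_psiE //.
  exact: S_piP_linear.
exact: S_piP0.
Qed.

Lemma Psi_balanced (X : finType) :
  balanced (fun (q : funR_right (S_functorR W) X) (v : V) => S_psi v q).
Proof.
split=> [v|q|q b v]; first exact: S_psi_linear.
- move=> a v v'; move: q; apply: S_ext => [||phi w].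
  + exact: S_psi_linear.
  + by apply: linear_lincomb; exact: S_psi_linear.
  + rewrite !S_psiE wtens_linearr L_tensr_linear.
    exact: S_pi_linear.
- move: q; apply: S_ext => [||phi w].
  + exact: (linear_comp (@S_psi_linear X v) (@S_ract_linearl _ _ _ W X b)).
  + exact: S_psi_linear.
  + rewrite /= S_ractE !S_psiE; congr (S_pi (L_tens _ _)).
    exact: (@tens_balanced _ _ (bi_right W)).
Qed.

Lemma Psi_linear (X : finType) : linear (@Psi_fun X).
Proof. exact: (tlift_linear (Psi_balanced X)). Qed.

Definition stens (X : finType) (q : S_obj W X) (v : V) :
    ftensor (S_functorR W) V X :=
  tens (q : funR_right (S_functorR W) X) v.

Lemma PsiE (X : finType) (phi : corr k X E) (w : W) (v : V) :
  Psi_fun (stens (S_pi (L_tens phi w)) v) = S_pi (L_tens phi (wtens w v)).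
Proof. by rewrite -S_psiE; exact: (tliftE (Psi_balanced X)). Qed.

Lemma Psi_natural (X Y : finType) (psi : corr k Y X)
  (t : ftensor (S_functorR W) V X) :
  Psi_fun (fmap psi t) = fmap psi (Psi_fun t).
Proof.
move: t; apply: tensor_ext => [||q v].
- exact: (linear_comp (@Psi_linear Y) (@fmap_linearr _ _ _ _ psi)).
- exact: (linear_comp (@fmap_linearr _ _ _ _ psi) (@Psi_linear X)).
rewrite -/(stens q v) [fmap psi (stens q v)]/= ftensor_mapE /=.
rewrite -/(stens _ v); move: q; apply: S_ext => [||phi w].
- apply: (linear_comp (@Psi_linear Y)).
  apply: (linear_comp (@tens_linearl _ _ (funR_right (S_functorR W) Y) V v)).
  exact: S_map_linearr.
- apply: (linear_comp (@S_map_linearr _ _ _ _ _ psi)).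
  apply: (linear_comp (@Psi_linear X)).
  exact: (@tens_linearl _ _ (funR_right (S_functorR W) X) V v).
- by rewrite S_mapE L_mapE !PsiE S_mapE L_mapE.
Qed.

Definition Psi : corrHom (ftensor (S_functorR W) V) (S_functor WV) :=
  CorrHom Psi_linear Psi_natural.

End Psi.

(* The product of permutations in fingroup applies its left factor first:
   the composite "alpha after beta" is (beta * alpha)%g.  The products below
   are reversed accordingly. *)

(* The poset (E, R) is E : finPOrderType d; R itself is ordrel E. *)
Definition ordrel d (E : finPOrderType d) : {set E * E} :=
  [set p | (p.1 <= p.2)%O].

Definition poset_aut d (E : finPOrderType d) : {set {perm E}} :=
  [set s : {perm E} | [forall x, forall y, (s x <= s y)%O == (x <= y)%O]].

Section Aut.
Variables (d : Order.disp_t) (E : finPOrderType d).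

Lemma poset_autP (s : {perm E}) :
  reflect (forall x y, (s x <= s y)%O = (x <= y)%O) (s \in poset_aut E).
Proof.
rewrite inE; apply: (iffP forallP) => [h x y|h x].
  by have /forallP/(_ y)/eqP := h x.
by apply/forallP => y; rewrite h.
Qed.

Lemma poset_aut_group_set : group_set (poset_aut E).
Proof.
apply/group_setP; split=> [|s t /poset_autP hs /poset_autP ht]; apply/poset_autP.
  by move=> x y; rewrite !perm1.
by move=> x y; rewrite !permM ht hs.
Qed.

Canonical poset_aut_group := Group poset_aut_group_set.

End Aut.

Notation poset_autT E := (subg_of (poset_aut_group E)).

(* The group algebra kA of A = Aut(E, R). *)
Definition aut_alg (k : comNzRingType) d (E : finPOrderType d) : Type :=
  fmod k (poset_autT E).

Section AutAlg.
Variables (k : comNzRingType) (d : Order.disp_t) (E : finPOrderType d).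
Local Notation kA := (aut_alg k E).

HB.instance Definition _ := GRing.Lmodule.copy kA (fmod k (poset_autT E)).

Definition aut_mul : kA -> kA -> kA :=
  fbil (fun s t : poset_autT E => basis k (t * s)%g).

Definition aut_one : kA := basis k (1%g : poset_autT E).

Lemma aut_mul_basis (s t : poset_autT E) :
  aut_mul (basis k s) (basis k t) = basis k (t * s)%g.
Proof. exact: fbil_basis. Qed.

Lemma aut_mul_linearl (b : kA) : linear (fun a => aut_mul a b).
Proof. exact: fbil_linearl. Qed.

Lemma aut_mul_linearr (a : kA) : linear (aut_mul a).
Proof. exact: fbil_linearr. Qed.

Lemma aut_mulA : associative aut_mul.
Proof.
move=> a b c; move: a; apply: fmod_ext => [||s].
- exact: aut_mul_linearl.
- exact: (linear_comp (aut_mul_linearl c) (aut_mul_linearl b)).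
move: b; apply: fmod_ext => [||t].
- exact: (linear_comp (@aut_mul_linearr _) (aut_mul_linearl c)).
- exact: (linear_comp (aut_mul_linearl c) (@aut_mul_linearr _)).
move: c; apply: fmod_ext => [||u].
- exact: (linear_comp (@aut_mul_linearr _) (@aut_mul_linearr _)).
- exact: aut_mul_linearr.
by rewrite !aut_mul_basis mulgA.
Qed.

Lemma aut_mul1l : left_id aut_one aut_mul.
Proof.
move=> a; move: a; apply: fmod_ext => [||s]; first exact: aut_mul_linearr.
- exact: linear_id.
- by rewrite aut_mul_basis mulg1.
Qed.

Lemma aut_mul1r : right_id aut_one aut_mul.
Proof.
move=> a; move: a; apply: fmod_ext => [||s]; first exact: aut_mul_linearl.
- exact: linear_id.
- by rewrite aut_mul_basis mul1g.
Qed.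

Lemma aut_mulDl : left_distributive aut_mul +%R.
Proof. by move=> a b c; exact: (linear_mapD (aut_mul_linearl c)). Qed.

Lemma aut_mulDr : right_distributive aut_mul +%R.
Proof. by move=> a b c; exact: (linear_mapD (@aut_mul_linearr a)). Qed.

HB.instance Definition _ := GRing.Zmodule_isNzRing.Build kA
  aut_mulA aut_mul1l aut_mul1r aut_mulDl aut_mulDr
  (basis_neq0 k (1%g : poset_autT E)).

Lemma aut_scaleAl (c : k) (a b : kA) : c *: (a * b) = (c *: a) * b.
Proof. exact: (esym (linear_mapZ (aut_mul_linearl b) c a)). Qed.

HB.instance Definition _ := GRing.Lmodule_isLalgebra.Build k kA aut_scaleAl.

Lemma aut_scaleAr (c : k) (a b : kA) : c *: (a * b) = a * (c *: b).
Proof. exact: (esym (linear_mapZ (@aut_mul_linearr a) c b)). Qed.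

HB.instance Definition _ := GRing.Lalgebra_isAlgebra.Build k kA aut_scaleAr.

End AutAlg.

Section Fundamental.
Variables (k : comNzRingType) (d : Order.disp_t) (E : finPOrderType d).
Implicit Types (Q : {set E * E}) (alpha beta : {perm E}) (tau : poset_autT E).
Local Notation P := (fmod k {perm E}).

(* Conjugated order ^alpha R. *)
Definition conjrel alpha : {set E * E} :=
  [set (alpha p.1, alpha p.2) | p in ordrel E].

Definition fund_rel Q alpha beta : bool :=
  (diagrel E \subset rcomp (permrel beta^-1) Q) &&
  (rcomp (permrel beta^-1) Q \subset conjrel alpha).

(* basis k alpha stands for Delta_alpha f_R; the permutation beta picked here
   is unique by fund_rel_uniq. *)
Definition fund_act Q alpha : P :=
  if [pick beta | fund_rel Q alpha beta] is Some beta
  then basis k (alpha * beta)%g else 0.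

Definition fund_ract alpha tau : P := basis k (sgval tau * alpha)%g.

Lemma fund_relP Q alpha beta :
  reflect ((forall e, (beta e, e) \in Q) /\
    forall a b, (beta a, b) \in Q ->
      ((alpha^-1)%g a <= (alpha^-1)%g b)%O)
  (fund_rel Q alpha beta).
Proof.
have rE x y : ((x, y) \in rcomp (permrel beta^-1) Q) = ((beta x, y) \in Q).
  apply/rcompP/idP => [[z]|h]; first by rewrite permrelE => /eqP ->; rewrite permKV.
  by exists (beta x); rewrite ?permrelE ?permK.
have cE x y : ((x, y) \in conjrel alpha) =
    ((alpha^-1)%g x <= (alpha^-1)%g y)%O.
  apply/imsetP/idP => [[[u v]]|h].
    by rewrite inE /= => uv [-> ->]; rewrite !permK.
  by exists ((alpha^-1)%g x, (alpha^-1)%g y); rewrite ?inE //= !permKV.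
apply: (iffP andP) => -[h1 h2]; split.
- by move=> e; rewrite -rE; apply: (subsetP h1); rewrite diagrelE.
- by move=> a b h; rewrite -cE; apply: (subsetP h2); rewrite rE.
- by apply/subsetP => -[a b]; rewrite diagrelE => /eqP ->; rewrite rE.
- by apply/subsetP => -[a b]; rewrite rE cE; apply: h2.
Qed.

Lemma perm_decr (s : {perm E}) : (forall x, (s x <= x)%O) -> s = 1%g.
Proof.
move=> hs; have hn n x : ((s ^+ n)%g x <= x)%O.
  elim: n x => [|n IHn] x; first by rewrite expg0 perm1.
  by rewrite expgSr permM; apply: (Order.POrderTheory.le_trans (hs _)).
apply/permP => x; rewrite perm1; apply: Order.POrderTheory.le_anti.
rewrite hs /=; have := hn #[s]%g.-1 (s x).
by rewrite -permM -expgS prednK ?order_gt0 // expg_order perm1.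
Qed.

Lemma fund_rel_uniq Q alpha beta beta' :
  fund_rel Q alpha beta -> fund_rel Q alpha beta' -> beta = beta'.
Proof.
move=> /fund_relP[h1 _] /fund_relP[_ h2].
suff: (alpha * (beta * beta'^-1) * alpha^-1)%g = 1%g.
  move/eqP; rewrite -eq_mulgV1 => /eqP/esym e.
  by apply/eqP; rewrite eq_mulgV1 -(can_eq (mulKg alpha)) -e mulg1.
apply: perm_decr => x; rewrite !permM; set y := alpha x.
have -> : x = (alpha^-1)%g y by rewrite permK.
by apply: h2; rewrite permKV.
Qed.

Lemma fund_actE Q alpha beta :
  fund_rel Q alpha beta -> fund_act Q alpha = basis k (alpha * beta)%g.
Proof.
rewrite /fund_act => h; case: pickP => [beta' h'|/(_ beta)]; last by rewrite h.
by rewrite (fund_rel_uniq h h').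
Qed.

Lemma fund_act0 Q alpha :
  (forall beta, ~~ fund_rel Q alpha beta) -> fund_act Q alpha = 0.
Proof. by rewrite /fund_act => h; case: pickP => // beta; rewrite (negPf (h _)). Qed.

Lemma fund_rel_diag alpha : fund_rel (diagrel E) alpha 1%g.
Proof.
by apply/fund_relP; split=> [e|a b]; rewrite perm1 diagrelE // => /eqP ->.
Qed.

Lemma fund_rel_comp Q Q' alpha beta beta' :
  fund_rel Q' alpha beta' -> fund_rel Q (alpha * beta')%g beta ->
  fund_rel (rcomp Q Q') alpha (beta' * beta)%g.
Proof.
move=> /fund_relP[h1 h2] /fund_relP[g1 g2]; apply/fund_relP; split=> [e|a b].
  by apply/rcompP; exists (beta' e); rewrite ?permM.
move=> /rcompP[y Qy Q'y]; rewrite permM in Qy; have := g2 _ _ Qy.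
rewrite invMg !permM permK => /Order.POrderTheory.le_trans; apply.
by apply: h2; rewrite permKV.
Qed.

Lemma fund_rel_factor Q Q' alpha gamma :
  fund_rel (rcomp Q Q') alpha gamma ->
  exists beta' : {perm E}, fund_rel Q' alpha beta' /\
    fund_rel Q (alpha * beta')%g (beta'^-1 * gamma)%g.
Proof.
move=> /fund_relP[h1 h2].
have ex e : exists y, ((gamma e, y) \in Q) && ((y, e) \in Q').
  by have /rcompP[y Qy Q'y] := h1 e; exists y; rewrite Qy.
pose f e := xchoose (ex e).
have fQ e : (gamma e, f e) \in Q by have /andP[] := xchooseP (ex e).
have fQ' e : (f e, e) \in Q' by have /andP[] := xchooseP (ex e).
have f_inj : injective f.
  move=> a b fab; apply: (@perm_inj _ (alpha^-1)%g).
  apply: Order.POrderTheory.le_anti; apply/andP; split; apply: h2.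
    by apply/rcompP; exists (f a) => //; rewrite fab.
  by apply/rcompP; exists (f b) => //; rewrite -fab.
exists (perm f_inj); split; apply/fund_relP; split.
- by move=> e; rewrite permE.
- by move=> a b; rewrite permE => h; apply: h2; apply/rcompP; exists (f a).
- move=> e; have {2}-> : e = perm f_inj (((perm f_inj)^-1)%g e) by rewrite permKV.
  by rewrite permM [X in (_, X)]permE.
- move=> a b; rewrite !invMg !permM => h; apply: h2; apply/rcompP.
  by exists b => //; rewrite -{1}[b](permKV (perm f_inj)) permE.
Qed.

Lemma fund_rel_aut Q alpha beta tau :
  fund_rel Q (sgval tau * alpha)%g beta = fund_rel Q alpha beta.
Proof.
have /poset_autP tauE := subgP tau.
have tE x y : (((sgval tau * alpha)^-1)%g x <= ((sgval tau * alpha)^-1)%g y)%O =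
    ((alpha^-1)%g x <= (alpha^-1)%g y)%O.
  by rewrite invMg !permM -[RHS]tauE -[in RHS]tauE ?permKV -tauE !permKV ?tauE.
by apply/fund_relP/fund_relP => -[h1 h2]; split=> // a b /h2; rewrite tE.
Qed.

Definition fund_lact : corr_alg k E -> P -> P := fbil fund_act.
Definition fund_rmul : P -> aut_alg k E -> P := fbil fund_ract.

Lemma fund_lact_linearr a : linear (fund_lact a).
Proof. exact: fbil_linearr. Qed.

Lemma fund_lact_linearl x : linear (fun a => fund_lact a x).
Proof. exact: fbil_linearl. Qed.

Lemma fund_lact_basis Q alpha :
  fund_lact (basis k Q) (basis k alpha) = fund_act Q alpha.
Proof. exact: fbil_basis. Qed.

Lemma fund_lact1 x : fund_lact 1 x = x.
Proof.
move: x; apply: fmod_ext => [||alpha]; first exact: fund_lact_linearr.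
- exact: linear_id.
- by rewrite fund_lact_basis (fund_actE (fund_rel_diag alpha)) mulg1.
Qed.

Lemma fund_act_comp Q Q' alpha :
  fund_act (rcomp Q Q') alpha = fund_lact (basis k Q) (fund_act Q' alpha).
Proof.
case: (pickP (fund_rel (rcomp Q Q') alpha)) => [gamma h|h].
  have [beta' [h1 h2]] := fund_rel_factor h.
  rewrite (fund_actE h) (fund_actE h1) fund_lact_basis (fund_actE h2).
  by rewrite mulgA mulgK.
rewrite fund_act0 => [|beta]; last by rewrite h.
case: (pickP (fund_rel Q' alpha)) => [beta' h'|h']; last first.
  rewrite fund_act0 => [|beta]; last by rewrite h'.
  by rewrite (linear_map0 (@fund_lact_linearr _)).
rewrite (fund_actE h') fund_lact_basis fund_act0 // => beta.
by apply/negP => g; have := h (beta' * beta)%g; rewrite (fund_rel_comp h' g).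
Qed.

Lemma fund_lactM a b x : fund_lact (a * b) x = fund_lact a (fund_lact b x).
Proof.
rewrite -[a * b]/(ccomp a b); move: a; apply: fmod_ext => [||Q].
- exact: (linear_comp (@fund_lact_linearl x) (@ccomp_linearl _ _ _ _ b)).
- exact: fund_lact_linearl.
move: b; apply: fmod_ext => [||Q'].
- exact: (linear_comp (@fund_lact_linearl x) (@ccomp_linearr _ _ _ _ (basis k Q))).
- exact: (linear_comp (@fund_lact_linearr _) (@fund_lact_linearl x)).
move: x; apply: fmod_ext => [||alpha].
- exact: fund_lact_linearr.
- exact: (linear_comp (@fund_lact_linearr _) (@fund_lact_linearr _)).
by rewrite ccomp_basis !fund_lact_basis fund_act_comp.
Qed.

Lemma fund_rmul_linearl b : linear (fun x => fund_rmul x b).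
Proof. exact: fbil_linearl. Qed.

Lemma fund_rmul_linearr x : linear (fund_rmul x).
Proof. exact: fbil_linearr. Qed.

Lemma fund_rmul_basis alpha tau :
  fund_rmul (basis k alpha) (basis k tau) = basis k (sgval tau * alpha)%g.
Proof. exact: fbil_basis. Qed.

Lemma fund_rmul1 x : fund_rmul x 1 = x.
Proof.
move: x; apply: fmod_ext => [||alpha]; first exact: fund_rmul_linearl.
- exact: linear_id.
- by rewrite fund_rmul_basis mul1g.
Qed.

Lemma fund_rmulM a b x : fund_rmul x (a * b) = fund_rmul (fund_rmul x a) b.
Proof.
rewrite -[a * b]/(aut_mul a b); move: a; apply: fmod_ext => [||s].
- exact: (linear_comp (@fund_rmul_linearr x) (@aut_mul_linearl _ _ _ b)).
- exact: (linear_comp (@fund_rmul_linearl b) (@fund_rmul_linearr x)).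
move: b; apply: fmod_ext => [||t].
- exact: (linear_comp (@fund_rmul_linearr x) (@aut_mul_linearr _ _ _ _)).
- exact: fund_rmul_linearr.
move: x; apply: fmod_ext => [||alpha].
- exact: fund_rmul_linearl.
- exact: (linear_comp (@fund_rmul_linearl _) (@fund_rmul_linearl _)).
by rewrite aut_mul_basis !fund_rmul_basis -mulgA.
Qed.

Lemma fund_lact_rmul a x b :
  fund_lact a (fund_rmul x b) = fund_rmul (fund_lact a x) b.
Proof.
move: a; apply: fmod_ext => [||Q].
- exact: fund_lact_linearl.
- exact: (linear_comp (@fund_rmul_linearl b) (@fund_lact_linearl x)).
move: b; apply: fmod_ext => [||tau].
- exact: (linear_comp (@fund_lact_linearr _) (@fund_rmul_linearr x)).
- exact: fund_rmul_linearr.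
move: x; apply: fmod_ext => [||alpha].
- exact: (linear_comp (@fund_lact_linearr _) (@fund_rmul_linearl _)).
- exact: (linear_comp (@fund_rmul_linearl _) (@fund_lact_linearr _)).
rewrite fund_rmul_basis !fund_lact_basis.
case: (pickP (fund_rel Q alpha)) => [beta h|h].
  rewrite (fund_actE h) fund_rmul_basis (fund_actE (beta := beta)) ?mulgA //.
  by rewrite fund_rel_aut.
rewrite !fund_act0 => [|beta|beta]; last 2 first.
- by rewrite h.
- by rewrite fund_rel_aut h.
by rewrite (linear_map0 (@fund_rmul_linearl _)).
Qed.

Definition fund_left : leftModule (corr_alg k E) :=
  LeftModule fund_lact_linearr fund_lact_linearl fund_lact1 fund_lactM.

Definition fund_module : bimodule (corr_alg k E) (aut_alg k E) :=
  @Bimodule k _ _ fund_left fund_rmul fund_rmul_linearl fund_rmul_linearr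
    fund_rmul1 fund_rmulM fund_lact_rmul.

Definition S_ER : corrFunctorR (aut_alg k E) := S_functorR fund_module.

Definition S_ERV (V : leftModule (aut_alg k E)) : corrFunctor k :=
  S_functor (tensor_left fund_module V).

Definition Psi_ER (V : leftModule (aut_alg k E)) :
    corrHom (ftensor S_ER V) (S_ERV V) :=
  Psi fund_module V.

End Fundamental.

Arguments fund_module k {d} E.
Arguments S_ER k {d} E.

(* Main.v *)
Require Import Defs.
From HB Require Import structures.
From mathcomp Require Import all_boot all_order all_algebra all_fingroup.
From mathcomp Require Import boolp.
From mathcomp Require Import ring.

Set Implicit Arguments.
Unset Strict Implicit.
Unset Printing Implicit Defensive.

Import GRing.Theory.
Local Open Scope ring_scope.

(* S_{E,R}(X) is spanned by the classes of psi (x) f_R, and it is the column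
   space of the matrix N(rho, phi) = [Delta_E <= rho phi <= R].  Writing rho as
   the family of the sets rho_x of E, every row of N is a product over x of
   indicators of phi_x <= C: for each e, the x such that rho_x has maximum e
   contribute prod [phi_x <= {>= e}] - prod [phi_x <= {> e}], and each x such
   that rho_x has no maximum contributes [phi_x <= upper bounds of rho_x].  So
   rows are words with letters in E and in a set G of subsets of E.  If one of
   {>= e} and {> e} is in G, adding the other to G does not change the span of
   the words; saturating G in this way and then discarding all {>= e} gives a
   family of words that still spans the rows, is permuted freely by A, and is
   unitriangular on suitable columns.  Hence S_{E,R}(X) is a free kA-module,
   and a dual basis made of combinations of rows of N, which S_{E,R,V} also
   sees, yields the inverse of Psi. *)

(** * Unitriangular matrices and transversals of free actions *)

Lemma prodr_bool (k : comNzRingType) (I : finType) (P b : pred I) :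
  \prod_(i | P i) (b i)%:R = [forall i, P i ==> b i]%:R :> k.
Proof.
case: forallP => [h|h]; first by rewrite big1 // => i Pi; have := h i; rewrite Pi /= => ->.
have /existsP[i] : [exists i, ~~ (P i ==> b i)].
  by rewrite -negb_forall; apply/forallP.
by rewrite negb_imply => /andP[Pi /negPf bi]; rewrite (bigD1 i) //= bi mul0r.
Qed.

(** If [v] is a nonzero row vector with [v *m A = 0], take [i] of maximal weight in its support. A
    further nonzero term of coordinate [i] of the product would come from a support index of larger
    weight, so that coordinate is [v 0 i], a contradiction. The weight spares an ordering of [I]. *)
Lemma unitriangular_right_inverse (k : fieldType) (I : finType) (T : I -> I -> k)
    (w : I -> nat) :
  (forall i, T i i = 1) ->
  (forall i j, i != j -> T i j != 0 -> (w j < w i)%N) ->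
  exists c : I -> I -> k, forall i j, \sum_l T i l * c l j = (i == j)%:R.
Proof.
move=> T1 Tw; pose A := \matrix_(i, j < #|I|) T (enum_val i) (enum_val j).
have : row_free A.
  apply: inj_row_free => v vA0; apply/eqP; apply: contraT => /rV0Pn[i0 vi0].
  case: (@arg_maxnP _ i0 (fun i => v 0 i != 0) (fun i => w (enum_val i)) vi0) => i vi wi.
  suff : v 0 i = 0 by move/eqP; rewrite (negPf vi).
  have /matrixP/(_ 0 i) := vA0; rewrite !mxE (bigD1 i) //= mxE T1 mulr1.
  rewrite big1 ?addr0 // => l li; rewrite mxE.
  have [->|vl] := eqVneq (v 0 l) 0; first by rewrite mul0r.
  have [->|Tli] := eqVneq (T (enum_val l) (enum_val i)) 0; first by rewrite mulr0.
  have := Tw _ _ _ Tli; rewrite (inj_eq enum_val_inj) => /(_ li).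
  by rewrite ltnNge; have := wi l vl; rewrite /geq /= => ->.
case/row_freeP => B AB; exists (fun i j => B (enum_rank i) (enum_rank j)) => i j.
have /matrixP/(_ (enum_rank i) (enum_rank j)) := AB.
rewrite !mxE (inj_eq enum_rank_inj) => <-.
rewrite (reindex_onto (@enum_val _ I) enum_rank) => [|l _]; last exact: enum_rankK.
rewrite (eq_bigl predT) => [|l]; last by rewrite enum_valK eqxx.
by apply: eq_bigr => l _; rewrite mxE !enum_rankK enum_valK.
Qed.

(* The indicator function of a set of orbit representatives. *)
Lemma free_action_transversal (R : nzRingType) (gT : finGroupType) (I : finType)
    (W : pred I) (to : I -> gT -> I) :
  (forall i, to i 1%g = i) -> (forall i a b, to i (a * b)%g = to (to i a) b) ->
  (forall i a, W i -> to i a = i -> a = 1%g) ->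
  exists c : I -> R, forall i, W i -> \sum_a c (to i a) = 1.
Proof.
move=> to1 toM tofree; pose orb i := [set to i a | a : gT].
have orbE i a : orb (to i a) = orb i.
  apply/setP => j; apply/imsetP/imsetP => -[b _ ->].
    by exists (a * b)%g; rewrite ?toM.
  by exists (a^-1 * b)%g; rewrite // -toM mulKVg.
(* The choice depends only on the set [orb i], so it gives one representative per orbit. *)
pose r i := [pick j in orb i].
exists (fun i => (Some i == r i)%:R) => i Wi.
have : exists a, r i = Some (to i a).
  rewrite /r; case: pickP => [_ /imsetP[a _ ->]|/(_ i)]; first by exists a.
  by move=> /imsetP[]; exists 1%g.
case=> a ra; rewrite (bigD1 a) //= [r _]/r orbE -/(r i) ra eqxx big1 ?addr0 // => b ba.
rewrite [r _]/r orbE -/(r i) ra; case: eqP => // -[e]; case/eqP: ba.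
apply/eqP; rewrite eq_mulgV1; apply/eqP/(tofree i) => //.
by rewrite toM e -toM mulgV.
Qed.

(** * Linear spans of finite families of functions *)

Section Span.
Variables (k : comNzRingType) (T : Type).

Definition in_span (I : finType) (P : pred I) (F : I -> T -> k) (v : T -> k) :=
  exists c : I -> k, forall t, v t = \sum_(i | P i) c i * F i t.

Lemma in_span_gen (I : finType) (P : pred I) (F : I -> T -> k) i :
  P i -> in_span P F (F i).
Proof.
move=> Pi; exists (fun j => (j == i)%:R) => t; rewrite (bigD1 i) //= eqxx mul1r.
by rewrite big1 ?addr0 // => j /andP[_ /negPf ->]; rewrite mul0r.
Qed.

Lemma in_spanB (I : finType) (P : pred I) (F : I -> T -> k) u v w :
  in_span P F u -> in_span P F v -> (forall t, w t = u t - v t) -> in_span P F w.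
Proof.
move=> [a ua] [b vb] wE; exists (fun i => a i - b i) => t.
by rewrite wE ua vb -sumrB; apply: eq_bigr => i _; rewrite mulrBl.
Qed.

Lemma in_span0 (I : finType) (P : pred I) (F : I -> T -> k) w :
  (forall t, w t = 0) -> in_span P F w.
Proof. by move=> w0; exists (fun=> 0) => t; rewrite big1 // => i _; rewrite mul0r. Qed.

Lemma in_span_trans (I J : finType) (P : pred I) (F : I -> T -> k)
    (Q : pred J) (G : J -> T -> k) v :
  in_span P F v -> (forall i, P i -> in_span Q G (F i)) -> in_span Q G v.
Proof.
move=> [c vc] FG.
have /choice[a aE] : forall i, exists a : J -> k,
    P i -> forall t, F i t = \sum_(j | Q j) a j * G j t.
  move=> i; have [Pi|nPi] := boolP (P i); last by exists (fun=> 0).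
  by have [a aE] := FG i Pi; exists a.
exists (fun j => \sum_(i | P i) c i * a i j) => t; rewrite vc.
under eq_bigr => i Pi do rewrite (aE i Pi) mulr_sumr.
rewrite exchange_big /=; apply: eq_bigr => j _; rewrite mulr_suml.
by apply: eq_bigr => i _; rewrite mulrA.
Qed.

End Span.

(** * Words, their functions and the toggling identity *)

Section Words.
Variables (k : comNzRingType) (d : Order.disp_t) (E : finPOrderType d) (X : finType).
Local Notation rel := {set X * E}.
Local Notation letter := (E + {set E})%type.
Local Notation word := {ffun X -> letter}.
Implicit Types (phi : rel) (f : word) (e : E) (C : {set E}) (G : {set {set E}}).

Definition fiber phi x : {set E} := [set e | (x, e) \in phi].
Definition above e : {set E} := [set b | (e <= b)%O].
Definition sabove e : {set E} := [set b | (e < b)%O].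

Definition inside phi x C : k := (fiber phi x \subset C)%:R.

(** Its values are 0 and 1: it tests that all fibres at the positions of [e] lie in [above e] and
    that at least one of them contains [e]. *)
Definition E_factor f phi e : k :=
  \prod_(x | f x == inl e) inside phi x (above e) -
  \prod_(x | f x == inl e) inside phi x (sabove e).

Definition word_fun f phi : k :=
  (\prod_e E_factor f phi e) *
  \prod_x (if f x is inr C then inside phi x C else 1).

Definition word_over G f : bool := [forall x, if f x is inr C then C \in G else true].

Lemma word_overP G f : reflect (forall x C, f x = inr C -> C \in G) (word_over G f).
Proof.
apply: (iffP forallP) => [h x C fx|h x]; first by have := h x; rewrite fx.
by case fx : (f x) => [//|C]; apply: (h x).
Qed.

Definition onto f : bool := [forall e, exists x, f x == inl e].

(** A letter [e] that does not occur contributes a difference of two empty products. *)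
Lemma word_fun0 f phi : ~~ onto f -> word_fun f phi = 0.
Proof.
rewrite negb_forall => /existsP[e]; rewrite negb_exists => /forallP fe.
have {}fe x : (f x == inl e) = false by apply/negbTE/fe.
rewrite /word_fun (bigD1 e) //= [E_factor _ _ e](_ : _ = 0) ?mul0r //.
by rewrite /E_factor !(big_pred0 _ _ _ _ fe) subrr.
Qed.

Lemma above_neq_sabove e : above e != sabove e.
Proof.
apply/eqP => /setP/(_ e).
by rewrite !inE Order.POrderTheory.lexx Order.POrderTheory.ltxx.
Qed.

Definition toggled C C' e : Prop :=
  (C = above e /\ C' = sabove e) \/ (C = sabove e /\ C' = above e).

(* Writing a, b for the two indicators attached to e, this is the identity
   a^Z (a^Y - b^Y) = (a^(Z+Y) - b^(Z+Y)) - (a^Z - b^Z) b^Y, where Z and Y are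
   the sets of positions of C and of e in f, and its mirror image. *)
Lemma word_fun_toggle f C C' e : toggled C C' e ->
  let f1 := [ffun x => if f x == inr C then inl e else f x] : word in
  let f2 := [ffun x => if f x == inr C then inl e else
                       if f x == inl e then inr C' else f x] : word in
  forall phi, word_fun f phi = word_fun f1 phi - word_fun f2 phi.
Proof.
move=> tCC f1 f2 phi.
have f1E x e' : (f1 x == inl e') =
    (f x == inl e') || ((f x == inr C) && (e' == e)).
  rewrite ffunE; case: (eqVneq (f x) (inr C)) => [->|_]; last by rewrite orbF.
  by rewrite /= eq_sym.
have f2E x e' : (f2 x == inl e') =
    if e' == e then f x == inr C else f x == inl e'.
  rewrite ffunE; case: (eqVneq (f x) (inr C)) => [->|_].
    by rewrite -[LHS]/(e == e') eq_sym; case: (e' == e).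
  case: (eqVneq (f x) (inl e)) => [->|fxe].
    by rewrite -[inl e == inl e']/(e == e') [e == e']eq_sym; case: (e' == e).
  by case: (eqVneq e' e) => // ->; rewrite (negPf fxe).
have fac1 e' : e' != e -> E_factor f1 phi e' = E_factor f phi e'.
  move=> /negPf ne; congr (_ - _); apply: eq_bigl => x;
    by rewrite f1E ne andbF orbF.
have fac2 e' : e' != e -> E_factor f2 phi e' = E_factor f phi e'.
  by move=> /negPf ne; congr (_ - _); apply: eq_bigl => x; rewrite f2E ne.
rewrite /word_fun !(bigD1 (P := predT) e) //=.
rewrite [in RHS](eq_bigr _ fac1) [in RHS](eq_bigr _ fac2).
(* The factors at elements other than [e] are common to [f], [f1] and [f2]. *)
set K := \prod_(i | i != e) _.
pose p (g : letter) D : k := \prod_(x | f x == g) inside phi x D.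
have U D : \prod_(x | f1 x == inl e) inside phi x D = p (inr C) D * p (inl e) D.
  rewrite (bigID (fun x => f x == inr C)) /=; congr (_ * _); apply: eq_bigl => x;
    rewrite f1E eqxx andbT;
    by case: (eqVneq (f x) (inr C)) => [->|_]; rewrite ?orbF ?orbT ?andbT ?andbF.
have V D : \prod_(x | f2 x == inl e) inside phi x D = p (inr C) D.
  by apply: eq_bigl => x; rewrite f2E eqxx.
rewrite /E_factor !U !V.
pose L := \prod_(x | f x != inr C)
   (if f x is inr D then inside phi x D else 1).
have L0 : \prod_x (if f x is inr D then inside phi x D else 1) = p (inr C) C * L.
  rewrite (bigID (fun x => f x == inr C)) /=; congr (_ * _).
  by apply: eq_bigr => x /eqP ->.
have L1 : \prod_x (if f1 x is inr D then inside phi x D else 1) = L.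
  rewrite (bigID (fun x => f x == inr C)) /= big1 ?mul1r => [|x fx].
    by apply: eq_bigr => x /negPf fx; rewrite ffunE fx.
  by rewrite ffunE fx.
have L2 : \prod_x (if f2 x is inr D then inside phi x D else 1) =
    p (inl e) C' * L.
  rewrite (bigID (fun x => f x == inr C)) /= big1 ?mul1r => [|x fx]; last first.
    by rewrite ffunE fx.
  rewrite (bigID (fun x => f x == inl e)) /= /L [in RHS](bigID (fun x => f x == inl e)) /=.
  rewrite [X in _ = _ * (X * _)]big1 ?mul1r => [|x /andP[_ /eqP ->] //].
  congr (_ * _).
    rewrite /p; apply: eq_big => x.
      by case: (eqVneq (f x) (inl e)) => [->|]; rewrite ?andbF.
    by move=> /andP[/negPf fx1 /eqP fx]; rewrite ffunE fx1 fx eqxx.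
  by apply: eq_bigr => x /andP[/negPf fx1 /negPf fx2]; rewrite ffunE fx1 fx2.
rewrite L0 L1 L2 -!/(p _ _) /=.
by case: tCC => -[-> ->]; ring.
Qed.

End Words.

(** * Families of subsets used as letters *)

Section Letters.
Variables (d : Order.disp_t) (E : finPOrderType d).
Implicit Types (e : E) (C D : {set E}) (G : {set {set E}}).

Definition is_max D e : bool := (e \in D) && [forall a in D, (a <= e)%O].

Definition ubounds D : {set E} := [set b | [forall a in D, (a <= b)%O]].

Definition row_letters : {set {set E}} :=
  [set C | [exists D : {set E}, [forall e, ~~ is_max D e] && (C == ubounds D)]].

Definition toggle_closed G : bool :=
  [forall e, (above e \in G) == (sabove e \in G)].

(** As an intersection, this is the least toggle-closed family containing [row_letters]; membership
    is exploited by choosing a suitable closed family [G]. *)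
Definition letters : {set {set E}} :=
  [set C | [forall G : {set {set E}}, (row_letters \subset G) && toggle_closed G ==>
    (C \in G)]].

(** The letter [inl e] already has leading set [above e]; dropping the sets [above e] makes leading
    sets determine letters. *)
Definition root_letters : {set {set E}} :=
  [set C in letters | [forall e : E, C != above e]].

Lemma is_max_uniq D e e' : is_max D e -> is_max D e' -> e = e'.
Proof.
move=> /andP[eD /forall_inP h] /andP[e'D /forall_inP h'].
by apply: Order.POrderTheory.le_anti; rewrite h' // h.
Qed.

Lemma toggledP G C C' e : toggle_closed G -> toggled C C' e -> C \in G -> C' \in G.
Proof. by move=> /forallP/(_ e)/eqP Ge [[-> ->]|[-> ->]]; rewrite Ge. Qed.

Lemma lettersP C : reflect
  (forall G, row_letters \subset G -> toggle_closed G -> C \in G) (C \in letters).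
Proof.
rewrite inE; apply: (iffP forallP) => [h G G0 Gc|h G].
  by have := h G; rewrite G0 Gc.
by apply/implyP => /andP[]; apply: h.
Qed.

Lemma letters_closed : toggle_closed letters.
Proof.
apply/forallP => e; apply/eqP; apply/lettersP/lettersP => h G G0 Gc.
  by apply: (toggledP Gc _ (h G G0 Gc)); left.
by apply: (toggledP Gc _ (h G G0 Gc)); right.
Qed.

Lemma sabove_sub_above e : sabove e \subset above e.
Proof. by apply/subsetP => b; rewrite !inE => /Order.POrderTheory.ltW. Qed.

Lemma mem_above e : e \in above e.
Proof. by rewrite inE. Qed.

Lemma above_inj : injective (@above _ E).
Proof.
move=> a b ab; apply: Order.POrderTheory.le_anti.
have := mem_above a; have := mem_above b.
by rewrite -{1}ab {2}ab !inE => -> ->.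
Qed.

End Letters.

Arguments row_letters {d} E.
Arguments letters {d} E.
Arguments root_letters {d} E.

(** * Reduced words span the same functions as words over the row letters *)

Section WordSpan.
Variables (k : comNzRingType) (d : Order.disp_t) (E : finPOrderType d) (X : finType).
Local Notation word := {ffun X -> E + {set E}}.
Implicit Types (f : word) (e : E) (C : {set E}) (G : {set {set E}}).

Definition words_span G : ({set X * E} -> k) -> Prop :=
  in_span (word_over G : pred word) (@word_fun k d E X).

(** In both words given by [word_fun_toggle] the letter [C] has been replaced by [e], and the only
    set that may be introduced is [C'], which lies in [G]. *)
Lemma words_span_toggle G C C' e f : toggled C C' e -> C' \in G ->
  word_over (C |: G) f -> words_span G (word_fun k f).
Proof.
move=> tC C'G /word_overP fG; apply: in_spanB (word_fun_toggle k f tC).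
- apply: in_span_gen; apply/word_overP => x D; rewrite ffunE.
  case: eqP => // /eqP fxC fx; have := fG _ _ fx; rewrite !inE.
  by case/orP => // /eqP DC; rewrite fx DC eqxx in fxC.
- apply: in_span_gen; apply/word_overP => x D; rewrite ffunE.
  case: eqP => // /eqP fxC; case: eqP => [_ [<-] //|_ fx].
  have := fG _ _ fx; rewrite !inE.
  by case/orP => // /eqP DC; rewrite fx DC eqxx in fxC.
Qed.

Lemma words_span_add G G' C C' e : toggled C C' e -> C' \in G ->
  (forall f, word_over G f -> words_span G' (word_fun k f)) ->
  forall f, word_over (C |: G) f -> words_span G' (word_fun k f).
Proof.
by move=> tC C'G h f /(words_span_toggle tC C'G) => /in_span_trans; apply.
Qed.

(** A maximal family [G] whose words stay in the span is toggle-closed, since toggling could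
    otherwise enlarge it; hence it contains [letters]. *)
Lemma words_span_letters f :
  word_over (letters E) f -> words_span (row_letters E) (word_fun k f).
Proof.
pose Q G := (row_letters E \subset G) &&
  `[< forall f, word_over G f -> words_span (row_letters E) (word_fun k f) >].
have Q0 : Q (row_letters E).
  by rewrite /Q subxx; apply/asboolP => g; apply: in_span_gen.
have [G maxG _] := maxset_exists Q0.
have /andP[G0 /asboolP Gspan] := maxsetp maxG.
have Gadd C C' e : toggled C C' e -> C' \in G -> C \in G.
  move=> tC C'G; have QC : Q (C |: G).
    apply/andP; split; first exact: (subset_trans G0 (subsetUr _ _)).
    by apply/asboolP; apply: words_span_add tC C'G Gspan.
  by rewrite -(maxsetsup maxG QC (subsetUr _ _)) setU11.
have Gc : toggle_closed G.
  apply/forallP => e; apply/eqP; apply/idP/idP; apply: Gadd.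
    by right.
  by left.
move=> /word_overP fF; apply: Gspan; apply/word_overP => x C /fF /lettersP; exact.
Qed.

(** Take again a maximal family [G], now between [root_letters] and [letters]. A missing letter of
    least cardinality must be some [above e]. The strictly smaller letter [sabove e] is then in [G],
    and toggling adds [above e] to [G], against maximality. *)
Lemma words_span_roots f :
  word_over (letters E) f -> words_span (root_letters E) (word_fun k f).
Proof.
pose Q G := (root_letters E \subset G) && (G \subset letters E) &&
  `[< forall f, word_over G f -> words_span (root_letters E) (word_fun k f) >].
have Q0 : Q (root_letters E).
  rewrite /Q subxx /=; apply/andP; split; last by apply/asboolP => g; apply: in_span_gen.
  by apply/subsetP => C; rewrite inE => /andP[].
have [G maxG _] := maxset_exists Q0.
have /andP[/andP[G0 GF] /asboolP Gspan] := maxsetp maxG.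
suff FG : letters E \subset G.
  by move=> /word_overP fF; apply: Gspan; apply/word_overP => x C /fF /(subsetP FG).
apply/subsetPn => -[C0 C0F C0G].
have P0 : (C0 \in letters E) && (C0 \notin G) by rewrite C0F.
case: (@arg_minnP _ C0 (fun C => (C \in letters E) && (C \notin G)) (fun C => #|C|) P0).
move=> C /andP[CF CG] Cmin.
have /existsP[e /eqP Ce] : [exists e, C == above e].
  apply: contraT; rewrite negb_exists => nC.
  by move/negP: CG; case; apply: (subsetP G0); rewrite inE CF.
have tC : toggled C (sabove e) e by left.
have sF := toggledP (letters_closed E) tC CF.
have sG : sabove e \in G.
  apply: contraT => sG; have := Cmin (sabove e); rewrite sF sG => /(_ isT).
  rewrite leqNgt => /negP; case; rewrite Ce proper_card //.
  by rewrite properEneq eq_sym above_neq_sabove sabove_sub_above.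
have QC : Q (C |: G).
  rewrite /Q (subset_trans G0 (subsetUr _ _)) subUset GF sub1set CF /=.
  by apply/asboolP; apply: words_span_add tC sG Gspan.
by move/negP: CG; case; rewrite -(maxsetsup maxG QC (subsetUr _ _)) setU11.
Qed.

(** Surjectivity onto [E] discards words whose function vanishes; it also makes the diagonal entries
    equal to 1 and the action of the automorphisms free. *)
Definition reduced f : bool := word_over (root_letters E) f && onto f.

Lemma words_span_reduced f : word_over (row_letters E) f ->
  in_span reduced (@word_fun k d E X) (word_fun k f).
Proof.
move=> /word_overP fG; have : word_over (letters E) f.
  by apply/word_overP => x C /fG CG; apply/lettersP => G /subsetP G0 _; apply: G0.
move=> /words_span_roots /in_span_trans; apply => g gG.
have [go|/(word_fun0 k) g0] := boolP (onto g); last exact: in_span0.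
by apply: in_span_gen; rewrite /reduced gG.
Qed.

Lemma reduced_span f : reduced f -> words_span (row_letters E) (word_fun k f).
Proof.
move=> /andP[/word_overP fG _]; apply: words_span_letters.
by apply/word_overP => x C /fG; rewrite inE => /andP[].
Qed.

End WordSpan.

(** * Rows of the compatibility matrix as words *)

Section Rows.
Variables (k : comNzRingType) (d : Order.disp_t) (E : finPOrderType d) (X : finType).
Local Notation word := {ffun X -> E + {set E}}.
Implicit Types (rho : {set E * X}) (phi : {set X * E}).

(** The entry of the matrix N at [(rho, phi)]; [coefS_col] identifies it with the coefficient of f_R
    in the action of [rcomp rho phi] on f_R. *)
Definition compatible rho phi : bool :=
  [forall e, (e, e) \in rcomp rho phi] &&
  [forall p in rcomp rho phi, (p.1 <= p.2)%O].

Definition cofiber rho x : {set E} := [set e | (e, x) \in rho].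

Definition row_word rho : word :=
  [ffun x => if [pick e | is_max (cofiber rho x) e] is Some e then inl e
             else inr (ubounds (cofiber rho x))].

Lemma row_word_inl rho x e :
  (row_word rho x == inl e) = is_max (cofiber rho x) e.
Proof.
rewrite ffunE; case: pickP => [e' m'|->] //.
rewrite -[LHS]/(e' == e); apply/eqP/idP => [<- //|m]; exact: is_max_uniq m' m.
Qed.

Lemma row_word_inr rho x C : row_word rho x = inr C ->
  [forall e, ~~ is_max (cofiber rho x) e] /\ C = ubounds (cofiber rho x).
Proof.
rewrite ffunE; case: pickP => // h [<-]; split=> //.
by apply/forallP => e; rewrite h.
Qed.

Lemma row_word_over rho : word_over (row_letters E) (row_word rho).
Proof.
apply/word_overP => x C /row_word_inr[h ->]; rewrite inE; apply/existsP.
by exists (cofiber rho x); rewrite h eqxx.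
Qed.

(** A relation can be prescribed independently at each [x]: a singleton realises a letter [inl e],
    and a set without maximum realises a letter [inr C]. So words over [row_letters] are exactly
    rows. *)
Lemma row_word_surj (f : word) : word_over (row_letters E) f ->
  exists rho, row_word rho = f.
Proof.
move=> /word_overP fG.
have /choice[D DE] : forall x, exists D : {set E}, match f x with
    | inl e => is_max D e
    | inr C => [forall e, ~~ is_max D e] && (C == ubounds D) end.
  move=> x; case fx : (f x) => [e|C].
    exists [set e]; rewrite /is_max set11 /=.
    by apply/forall_inP => a; rewrite inE => /eqP ->.
  by have := fG _ _ fx; rewrite inE => /existsP.
exists [set p | p.1 \in D p.2]; apply/ffunP => x.
have cD : cofiber [set p | p.1 \in D p.2] x = D x by apply/setP => e; rewrite !inE.
have := DE x; case fx : (f x) => [e|C].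
  by move=> m; apply/eqP; rewrite row_word_inl cD.
move=> /andP[/forallP h /eqP ->]; rewrite ffunE cD; case: pickP => // e.
by rewrite (negPf (h e)).
Qed.

Lemma E_factor_bool (f : word) phi e : E_factor k f phi e =
  ([forall x, (f x == inl e) ==> (fiber phi x \subset above e)] &&
   ~~ [forall x, (f x == inl e) ==> (fiber phi x \subset sabove e)])%:R.
Proof.
rewrite /E_factor !prodr_bool.
set a := [forall x, _]; set b := [forall x, _].
have ba : b -> a.
  move=> /forallP h; apply/forallP => x; apply/implyP => fx.
  by have := h x; rewrite fx => /subset_trans; apply; apply: sabove_sub_above.
by case: a ba; case: b => //= ba; rewrite ?subrr ?subr0 //; have := ba isT.
Qed.

(** The upper inclusion says that, for each [x], every element of the fibre of [phi] bounds the
    cofiber of [rho]; if the cofiber has maximum [e], this means that the fibre lies in [above e].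
    Under this condition, [(e, e)] is in the composite through [x] exactly when [e] is the maximum
    of the cofiber and belongs to the fibre. *)
Lemma compatible_word_fun rho phi :
  (compatible rho phi)%:R = word_fun k (row_word rho) phi.
Proof.
rewrite /word_fun; under eq_bigr => e _ do rewrite E_factor_bool.
set f := row_word rho.
pose lit x := if f x is inr C then fiber phi x \subset C else true.
rewrite (eq_bigr (fun x => (lit x)%:R)) => [|x _]; last by rewrite /lit; case: (f x).
rewrite !prodr_bool -natrM mulnb; congr (nat_of_bool _)%:R.
apply/andP/andP => -[/forallP h1 h2]; split.
- move/forall_inP: h2 => h2; apply/forallP => e /=; apply/andP; split.
    apply/forallP => x; apply/implyP; rewrite row_word_inl => /andP[].
    rewrite inE => ex _; apply/subsetP => b; rewrite !inE => xb.
    by apply: (h2 (e, b)); apply/rcompP; exists x.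
  have /rcompP[x ex xe] := h1 e.
  apply/negP => /forallP/(_ x); rewrite row_word_inl.
  have -> : is_max (cofiber rho x) e.
    rewrite /is_max inE ex; apply/forall_inP => a; rewrite inE => ax.
    by apply: (h2 (a, e)); apply/rcompP; exists x.
  by move=> /subsetP/(_ e); rewrite !inE Order.POrderTheory.ltxx => /(_ xe).
- move/forall_inP: h2 => h2; apply/forallP => x /=; rewrite /lit.
  case fx : (f x) => [//|C]; have [_ ->] := row_word_inr fx.
  apply/subsetP => b; rewrite !inE => xb; apply/forall_inP => a; rewrite inE => ax.
  by apply: (h2 (a, b)); apply/rcompP; exists x.
- apply/forallP => e; have /andP[/forallP ha] := h1 e.
  rewrite negb_forall => /existsP[x]; rewrite negb_imply => /andP[fx /subsetPn[b]].
  rewrite !inE => xb be; have := ha x; rewrite fx => /subsetP/(_ b).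
  rewrite !inE => /(_ xb) eb.
  move: be; rewrite Order.POrderTheory.lt_neqAle eb andbT negbK => /eqP eb'; subst b.
  apply/existsP; exists x; rewrite /= xb andbT.
  by move: fx; rewrite row_word_inl => /andP[]; rewrite inE.
- move/forallP: h2 => h2.
  apply/forall_inP => -[a b] /rcompP[x ax xb] /=.
  have := h2 x; rewrite /lit /=; case fx : (f x) => [e|C].
    have /andP[/forallP/(_ x) + _] := h1 e; rewrite fx eqxx => /subsetP/(_ b).
    rewrite !inE => /(_ xb) eb _; apply: Order.POrderTheory.le_trans eb.
    move/eqP: fx; rewrite row_word_inl => /andP[_ /forall_inP]; apply.
    by rewrite inE.
  have [_ ->] := row_word_inr fx; move=> /subsetP/(_ b); rewrite !inE => /(_ xb).
  by move=> /forall_inP; apply; rewrite inE.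
Qed.

End Rows.

(** * Unitriangularity on leading columns *)

Section Triangular.
Variables (k : comNzRingType) (d : Order.disp_t) (E : finPOrderType d) (X : finType).
Local Notation word := {ffun X -> E + {set E}}.
Implicit Types (f g : word).

(** The largest fibre that the letter of [f] at [x] allows. *)
Definition lead f x : {set E} :=
  match f x with inl e => above e | inr C => C end.

Definition lead_column f : {set X * E} := [set p | p.2 \in lead f p.1].

Lemma fiber_lead_column f x : fiber (lead_column f) x = lead f x.
Proof. by apply/setP => e; rewrite !inE. Qed.

Lemma lead_inj f g : reduced f -> reduced g ->
  (forall x, lead f x = lead g x) -> f = g.
Proof.
have root f' x C e : word_over (root_letters E) f' -> f' x = inr C -> C = above e -> False.
  move=> /word_overP h /h; rewrite inE => /andP[_ /forallP/(_ e)] + Ce.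
  by rewrite Ce eqxx.
move=> /andP[fr _] /andP[gr _] h; apply/ffunP => x; have := h x; rewrite /lead.
case fx : (f x) => [a|A]; case gx : (g x) => [b|B].
- by move/above_inj ->.
- by move/esym/(root _ _ _ _ gr gx).
- by move/(root _ _ _ _ fr fx).
- by move ->.
Qed.

(** Each [e] occurs in [f], so the subtracted product contains the false inclusion of [above e] in
    [sabove e]; every remaining indicator is 1. *)
Lemma word_fun_lead f : onto f -> word_fun k f (lead_column f) = 1.
Proof.
move=> /forallP fo; rewrite /word_fun !big1 ?mulr1 // => [x _|e _].
  case fx : (f x) => [//|C].
  by rewrite /inside fiber_lead_column /lead fx subxx.
have /existsP[x fx] := fo e.
rewrite /E_factor big1 => [|y /eqP fy]; last first.
  by rewrite /inside fiber_lead_column /lead fy subxx.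
rewrite (bigD1 x) //= /inside fiber_lead_column /lead (eqP fx).
rewrite (_ : above e \subset sabove e = false) ?mul0r ?subr0 //.
by apply/negP => /subsetP/(_ e (mem_above e)); rewrite inE Order.POrderTheory.ltxx.
Qed.

(** A fibre not contained in [lead f x] kills the factor of a letter [inr C], and kills both
    products of a letter [inl e] because [sabove e] is contained in [above e]. *)
Lemma word_fun_lead_neq0 f g : word_fun k f (lead_column g) != 0 ->
  forall x, lead g x \subset lead f x.
Proof.
move=> nz x; apply: contraNT nz => gf; apply/eqP; rewrite /word_fun.
case fx : (f x) => [e|C]; last first.
  rewrite [X in _ * X](bigD1 x) //= fx /inside fiber_lead_column.
  by move: gf; rewrite /lead fx => /negPf ->; rewrite mul0r mulr0.
rewrite (bigD1 e) //= [E_factor _ _ _ e](_ : _ = 0) ?mul0r //.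
move: gf; rewrite {2}/lead fx => gf.
rewrite /E_factor !(bigD1 (P := fun y => f y == inl e) x) ?fx ?eqxx //=.
rewrite /inside fiber_lead_column (negPf gf).
rewrite (_ : lead g x \subset sabove e = false) ?mul0r ?subrr //.
apply: contraNF gf => /subset_trans; apply; exact: sabove_sub_above.
Qed.

End Triangular.

(** Evaluating reduced words at leading columns gives a unitriangular matrix for the total size of
    the leading sets: a nonzero entry forces inclusions of leading sets, and equality everywhere
    forces equal words by [lead_inj]. *)
Lemma word_fun_dual_basis (k : fieldType) (d : Order.disp_t) (E : finPOrderType d)
    (X : finType) :
  exists Q : {set X * E} -> {ffun X -> E + {set E}} -> k, forall f g,
    reduced f -> reduced g -> \sum_phi word_fun k f phi * Q phi g = (f == g)%:R.
Proof.
(* The identity outside reduced words keeps the matrix unitriangular over the whole finite type of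
   words. *)
pose T (f g : {ffun X -> E + {set E}}) :=
  if reduced f && reduced g then word_fun k f (lead_column g)
              else (f == g)%:R.
pose w (f : {ffun X -> E + {set E}}) := (\sum_x #|lead f x|)%N.
have [|f g fg|c cT] := @unitriangular_right_inverse k _ T w.
- move=> f; rewrite /T; case: ifP => [/andP[/andP[_ fo] _]|_]; last by rewrite eqxx.
  exact: word_fun_lead.
- rewrite /T; case: ifP => [/andP[fr gr]|_]; last by rewrite (negPf fg) eqxx.
  move=> /word_fun_lead_neq0 gf.
  have [le e] := leqif_sum (fun x (_ : true) => subset_leqif_cards (gf x)).
  rewrite /w ltn_neqAle le e andbT; apply: contra fg => /forallP h.
  by apply/eqP/esym/lead_inj => // x; apply/eqP; have := h x.
(* The right inverse is indexed by words; its rows are moved to the leading columns of those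
   words. *)
exists (fun phi g => \sum_(l | reduced l && (lead_column l == phi)) c l g).
move=> f g fr gr; rewrite -cT [RHS](bigID (@reduced d E X)) /= addrC.
rewrite [X in _ = X + _]big1 ?add0r; last first.
  move=> l nl; rewrite /T (negPf nl) andbF; case: eqP => [fl|]; last by rewrite mul0r.
  by rewrite -fl fr in nl.
rewrite [RHS](partition_big (@lead_column d E X) predT) //=; apply: eq_bigr => phi _.
rewrite mulr_sumr; apply: eq_bigr => l /andP[lr /eqP <-].
by rewrite /T fr lr.
Qed.

(** * The action of poset automorphisms on words *)

Section AutAction.
Variables (k : comNzRingType) (d : Order.disp_t) (E : finPOrderType d) (X : finType).
Local Notation word := {ffun X -> E + {set E}}.
Local Notation A := (poset_autT E).
Implicit Types (f g : word) (a b tau : A) (e : E) (C : {set E}).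

Definition word_act f tau : word :=
  [ffun x => match f x with
             | inl e => inl (sgval tau e)
             | inr C => inr (sgval tau @: C) end].

Lemma word_act1 f : word_act f 1%g = f.
Proof.
apply/ffunP => x; rewrite ffunE; case: (f x) => [e|C]; first by rewrite /= perm1.
by congr inr; rewrite (eq_imset (g := id)) ?imset_id // => e; rewrite /= perm1.
Qed.

Lemma word_actM f a b : word_act f (a * b)%g = word_act (word_act f a) b.
Proof.
apply/ffunP => x; rewrite !ffunE; case: (f x) => [e|C]; first by rewrite /= permM.
by congr inr; rewrite -imset_comp; apply: eq_imset => e; rewrite /= permM.
Qed.

Lemma autE tau e e' : (sgval tau e <= sgval tau e')%O = (e <= e')%O.
Proof. by have /poset_autP -> := subgP tau. Qed.

Lemma above_aut tau e : above (sgval tau e) = sgval tau @: above e.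
Proof.
apply/setP => b; rewrite -[b](permKV (sgval tau)) mem_imset ?inE ?autE //.
exact: perm_inj.
Qed.

Lemma sabove_aut tau e : sabove (sgval tau e) = sgval tau @: sabove e.
Proof.
apply/setP => b; rewrite -[b](permKV (sgval tau)) mem_imset; last exact: perm_inj.
by rewrite !inE !Order.POrderTheory.lt_leAnge !autE.
Qed.

Lemma ubounds_aut tau C : ubounds (sgval tau @: C) = sgval tau @: ubounds C.
Proof.
apply/setP => b; rewrite -[b](permKV (sgval tau)) mem_imset; last exact: perm_inj.
rewrite !inE; apply/forall_inP/forall_inP => [h e eC|h _ /imsetP[e eC ->]].
  by rewrite -(autE tau); apply: h; rewrite imset_f.
by rewrite autE; apply: h.
Qed.

Lemma is_max_aut tau C e : is_max (sgval tau @: C) (sgval tau e) = is_max C e.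
Proof.
rewrite /is_max mem_imset; last exact: perm_inj.
congr (_ && _); apply/forall_inP/forall_inP => [h a aC|h _ /imsetP[a aC ->]].
  by rewrite -(autE tau); apply: h; rewrite imset_f.
by rewrite autE; apply: h.
Qed.

Lemma row_letters_aut tau C : C \in row_letters E -> sgval tau @: C \in row_letters E.
Proof.
rewrite !inE => /existsP[D /andP[/forallP h /eqP ->]]; apply/existsP.
exists (sgval tau @: D); rewrite ubounds_aut eqxx andbT; apply/forallP => e.
by rewrite -[e](permKV (sgval tau)) is_max_aut.
Qed.

Lemma letters_aut tau C : C \in letters E -> sgval tau @: C \in letters E.
Proof.
move=> /lettersP CF; apply/lettersP => G /subsetP G0 Gc.
(* The preimage of a closed family under an automorphism is again closed. *)
have /(_ [set D : {set E} | sgval tau @: D \in G]) := CF; rewrite inE; apply.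
  by apply/subsetP => D D0; rewrite inE; apply/G0/row_letters_aut.
apply/forallP => e; rewrite !inE -above_aut -sabove_aut.
exact: (forallP Gc).
Qed.

Lemma root_letters_aut tau C :
  C \in root_letters E -> sgval tau @: C \in root_letters E.
Proof.
rewrite inE => /andP[CF /forallP Cr]; rewrite inE letters_aut //=.
apply/forallP => e; apply: contra (Cr ((sgval tau)^-1%g e)) => /eqP h.
apply/eqP/(imset_inj (@perm_inj _ (sgval tau))).
by rewrite h -above_aut permKV.
Qed.

Lemma reduced_act f tau : reduced f -> reduced (word_act f tau).
Proof.
move=> /andP[/word_overP fr /forallP fo]; apply/andP; split.
  apply/word_overP => x C; rewrite ffunE; case fx : (f x) => [//|D] [<-].
  exact/root_letters_aut/(fr x).
apply/forallP => e; have /existsP[x /eqP fx] := fo ((sgval tau)^-1%g e).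
by apply/existsP; exists x; rewrite ffunE fx permKV.
Qed.

(** Every element of [E] occurs as a letter of [f], so an automorphism fixing [f] fixes every
    element. *)
Lemma word_act_free f tau : reduced f -> word_act f tau = f -> tau = 1%g.
Proof.
move=> /andP[_ /forallP fo] ft; apply/val_inj/permP => e /=; rewrite perm1.
have /existsP[x /eqP fx] := fo e.
by move/ffunP/(_ x): ft; rewrite ffunE fx => -[].
Qed.

Lemma fiber_act (phi : {set X * E}) tau x :
  fiber (rcomp phi (permrel (sgval tau))) x = sgval tau @^-1: fiber phi x.
Proof.
apply/setP => e; rewrite !inE /=; apply/existsP/idP => [[y]|h].
  by rewrite permrelE => /andP[+ /eqP <-].
by exists (sgval tau e); rewrite permrelE h eqxx.
Qed.

Lemma inside_act (phi : {set X * E}) tau x C :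
  inside k (rcomp phi (permrel (sgval tau))) x C = inside k phi x (sgval tau @: C).
Proof.
rewrite /inside fiber_act; congr (nat_of_bool _)%:R.
apply/subsetP/subsetP => h e; last first.
  by rewrite inE => /h; rewrite mem_imset //; apply: perm_inj.
rewrite -[e](permKV (sgval tau)) mem_imset; last exact: perm_inj.
by move=> ephi; apply: h; rewrite inE.
Qed.

(** Composing [phi] with the graph of [tau] takes preimages of its fibres, which amounts to taking
    images of the sets tested by the word. Thus translation of columns permutes the word
    functions. *)
Lemma word_fun_act f (phi : {set X * E}) tau :
  word_fun k f (rcomp phi (permrel (sgval tau))) = word_fun k (word_act f tau) phi.
Proof.
rewrite /word_fun; congr (_ * _); last first.
  apply: eq_bigr => x _; rewrite ffunE; case: (f x) => // C; exact: inside_act.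
rewrite [RHS](reindex_inj (@perm_inj _ (sgval tau))); apply: eq_bigr => e _.
have fE x : (word_act f tau x == inl (sgval tau e)) = (f x == inl e).
  rewrite ffunE; case: (f x) => // e'.
  exact: (inj_eq (@perm_inj _ (sgval tau)) e' e).
rewrite /E_factor !(eq_bigl _ _ fE) above_aut sabove_aut.
by congr (_ - _); apply: eq_bigr => x _; rewrite inside_act.
Qed.

End AutAction.

(* Higman's criterion: the column space of the compatibility matrix is
   relatively projective, hence projective, over the group algebra. *)
Lemma compatible_higman (k : fieldType) (d : Order.disp_t) (E : finPOrderType d)
    (X : finType) :
  exists u : {set X * E} -> {set E * X} -> k,
  forall rho' phi,
    \sum_psi \sum_rho u psi rho *
      \sum_(tau : poset_autT E)
        (compatible rho (rcomp phi (permrel (sgval (tau^-1)%g))))%:R *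
        (compatible rho' (rcomp psi (permrel (sgval tau))))%:R
    = (compatible rho' phi)%:R :> k.
Proof.
have [Q QE] := word_fun_dual_basis k E X.
have [c cE] := free_action_transversal k (@word_act1 d E X) (@word_actM d E X)
  (@word_act_free d E X).
have /choice[B BE] : forall rho, exists b : {ffun X -> E + {set E}} -> k, forall phi,
    (compatible rho phi)%:R = \sum_(f | reduced f) b f * word_fun k f phi.
  move=> rho; have [b bE] := words_span_reduced k (row_word_over rho).
  by exists b => phi; rewrite compatible_word_fun bE.
have /choice[C CE] : forall f, exists a : {set E * X} -> k, reduced f ->
    forall phi, word_fun k f phi = \sum_rho a rho * (compatible rho phi)%:R.
  move=> f; case: (boolP (reduced f)) => [fr|]; last by exists (fun=> 0).
  have [|a aE] := in_span_trans (Q := predT)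
    (G := fun (rho : {set E * X}) phi => (compatible rho phi)%:R) (reduced_span k fr).
    move=> g /row_word_surj[rho <-].
    have [b bE] := in_span_gen (fun (rho : {set E * X}) phi => (compatible rho phi)%:R : k)
      (isT : predT rho).
    by exists b => phi; rewrite -compatible_word_fun bE.
  by exists a => _.
(* [C] writes the function of [f] through rows, [Q] through dual columns, and [c] keeps one word per
   orbit; the sum of the translates over [tau] restores all the words. *)
exists (fun psi rho => \sum_(f | reduced f) Q psi f * c f * C f rho) => rho' phi /=.
transitivity (\sum_(tau : poset_autT E) \sum_(f | reduced f) c f *
    (\sum_psi (compatible rho' (rcomp psi (permrel (sgval tau))))%:R * Q psi f) *
    word_fun k f (rcomp phi (permrel (sgval (tau^-1)%g)))).
  under eq_bigr => psi _ do under eq_bigr => rho _ do rewrite mulr_sumr.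
  under eq_bigr => psi _ do rewrite exchange_big /=.
  rewrite exchange_big /=; apply: eq_bigr => tau _.
  under eq_bigr => psi _ do under eq_bigr => rho _ do rewrite mulr_suml.
  under eq_bigr => psi _ do rewrite exchange_big /=.
  rewrite exchange_big /=; apply: eq_bigr => f fr.
  rewrite [c f * _]mulr_sumr mulr_suml; apply: eq_bigr => psi _.
  by rewrite CE // mulr_sumr; apply: eq_bigr => rho _; ring.
transitivity (\sum_(tau : poset_autT E) \sum_(g | reduced g) B rho' g * c (word_act g tau) *
    word_fun k g phi).
  apply: eq_bigr => tau _.
  have psiE f : reduced f ->
      \sum_psi (compatible rho' (rcomp psi (permrel (sgval tau))))%:R * Q psi f =
      \sum_(g | reduced g) B rho' g * (word_act g tau == f)%:R.
    move=> fr; under eq_bigr => psi _ do rewrite BE mulr_suml.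
    rewrite exchange_big /=; apply: eq_bigr => g gr.
    rewrite -QE ?reduced_act // mulr_sumr; apply: eq_bigr => psi _.
    by rewrite -mulrA word_fun_act.
  under eq_bigr => f fr do rewrite psiE // mulr_sumr mulr_suml.
  rewrite exchange_big /=; apply: eq_bigr => g gr.
  (* Duality leaves only the translate of [g] by [tau]; the shift of [phi] by the inverse of [tau]
     turns it back into [g]. *)
  rewrite (bigD1 (word_act g tau)) ?reduced_act //= eqxx big1 => [|f /andP[_ /negPf fg]].
    rewrite -[((sgval tau)^-1)%g]/(sgval (tau^-1)%g).
    by rewrite word_fun_act -word_actM mulgV word_act1 mulr1; ring.
  by rewrite eq_sym fg !mulr0 mul0r.
rewrite exchange_big /= BE; apply: eq_bigr => g gr.
(* Over the orbit of [g] the weights [c] add up to 1. *)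
rewrite -[RHS]mulr1 -(cE g gr) mulr_sumr; apply: eq_bigr => tau _; ring.
Qed.

(** * Evaluation pairings on the quotient by J *)

Section Evaluation.
Variables (k : comNzRingType) (E : finType) (W : leftModule (corr_alg k E)).
Implicit Types (X : finType).

(** J is the common kernel of these pairings, so they descend to the quotient and jointly separate
    its elements. *)
Definition S_ev X (rho : corr k E X) : S_obj W X -> W :=
  qlift (J_sub W X) (tlift (fun (phi : corr_right k X E) (w : W) =>
    lact (ccomp rho phi : corr_alg k E) w)).

Lemma S_ev_balanced X (rho : corr k E X) :
  balanced (fun (phi : corr_right k X E) (w : W) =>
    lact (ccomp rho phi : corr_alg k E) w).
Proof.
split=> [w|phi|phi b w].
- exact: (@linear_comp k _ _ _ (fun a : corr_alg k E => lact a w) _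
    (lact_linearl w) (@ccomp_linearr k E X E rho)).
- exact: lact_linearr.
- by rewrite -lactM /= ccompA.
Qed.

Lemma S_ev_J X (rho : corr k E X) t : J_sub W X t ->
  tlift (fun (phi : corr_right k X E) (w : W) =>
    lact (ccomp rho phi : corr_alg k E) w) t = 0.
Proof.
move=> [s [-> s0]].
rewrite (linear_map_sum (tlift_linear (S_ev_balanced rho))) -[RHS](s0 rho).
by apply: eq_bigr => p _; rewrite (tliftE (S_ev_balanced rho)).
Qed.

Lemma S_evE X (rho : corr k E X) phi w :
  S_ev rho (S_pi (L_tens phi w)) = lact (ccomp rho phi : corr_alg k E) w.
Proof.
rewrite /S_ev /S_pi qliftE ?(tliftE (S_ev_balanced rho)) //.
  exact: (tlift_linear (S_ev_balanced rho)).
exact: S_ev_J.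
Qed.

Lemma S_ev_linear X (rho : corr k E X) : linear (S_ev rho).
Proof.
by apply: qlift_linear; [exact: (tlift_linear (S_ev_balanced rho))|exact: S_ev_J].
Qed.

Lemma S_ev_linearl X (q : S_obj W X) : linear (fun rho => S_ev rho q).
Proof.
move=> a r r'; move: q; apply: S_ext => [||phi w]; first exact: S_ev_linear.
- by apply: linear_lincomb; exact: S_ev_linear.
- rewrite !S_evE ccomp_linearl; exact: lact_linearl.
Qed.

Lemma S_ev_eq0 X (q : S_obj W X) : (forall rho, S_ev rho q = 0) -> q = 0.
Proof.
have [t ->] := S_piP q => q0; apply/qpi_eq0.
have [s ts] := tensor_sum t; exists s; split=> // rho.
rewrite -[RHS](q0 rho) ts (linear_map_sum (@S_pi_linear _ _ W X)).
rewrite (linear_map_sum (S_ev_linear rho)).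
by apply: eq_bigr => p _; rewrite -/(L_tens p.1 p.2) S_evE.
Qed.

End Evaluation.

Lemma S_ev_ract (k : comNzRingType) (E : finType) (B : algType k)
    (W : bimodule (corr_alg k E) B) (X : finType) (rho : corr k E X)
    (q : S_obj W X) b :
  S_ev rho (S_ract q b) = bact (S_ev rho q) b.
Proof.
move: q; apply: S_ext => [||phi w].
- exact: (linear_comp (@S_ev_linear _ _ W X rho) (@S_ract_linearl _ _ _ W X b)).
- exact: (linear_comp (@bact_linearl _ _ _ W b) (@S_ev_linear _ _ W X rho)).
- by rewrite S_ractE !S_evE bact_lact.
Qed.

Lemma stens_linearl (k : comNzRingType) (E : finType) (B : algType k)
    (W : bimodule (corr_alg k E) B) (V : leftModule B) (X : finType) (v : V) :
  linear (fun q : S_obj W X => stens q v).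
Proof. exact: (@tens_linearl _ _ (funR_right (S_functorR W) X) V v). Qed.

Lemma stens_linearr (k : comNzRingType) (E : finType) (B : algType k)
    (W : bimodule (corr_alg k E) B) (V : leftModule B) (X : finType) (q : S_obj W X) :
  linear (fun v : V => stens q v).
Proof. exact: (@tens_linearr _ _ (funR_right (S_functorR W) X) V q). Qed.

Lemma stens_ract (k : comNzRingType) (E : finType) (B : algType k)
    (W : bimodule (corr_alg k E) B) (V : leftModule B) (X : finType)
    (q : S_obj W X) b (v : V) :
  stens (S_ract q b) v = stens q (lact b v).
Proof. exact: (@tens_balanced _ _ (funR_right (S_functorR W) X) V q b v). Qed.

(** Coordinates built from evaluations are thereby readable after applying Psi, which is what its
    inverse relies on. *)
Lemma S_ev_Psi (k : comNzRingType) (E : finType) (B : algType k)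
    (W : bimodule (corr_alg k E) B) (V : leftModule B) (X : finType)
    (rho : corr k E X) (q : S_obj W X) (v : V) :
  S_ev rho (Psi_fun (stens q v)) = wtens (S_ev rho q) v.
Proof.
move: q; apply: S_ext => [||phi w].
- apply: (linear_comp (@S_ev_linear _ _ (tensor_left W V) X rho)).
  exact: (linear_comp (@Psi_linear _ _ _ W V X) (stens_linearl v)).
- exact: (linear_comp (@wtens_linearl _ _ _ W V v) (@S_ev_linear _ _ W X rho)).
- by rewrite PsiE !S_evE lact_wtens.
Qed.

(** * Coefficients in the fundamental module *)

Section FundamentalProjection.
Variables (k : comNzRingType) (d : Order.disp_t) (E : finPOrderType d).
Local Notation A := (poset_autT E).
Local Notation P := (fmod k {perm E}).

Lemma fcoef_basis (T : finType) (x y : T) : fcoef (basis k x) y = (y == x)%:R.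
Proof. by rewrite /fcoef ffunE. Qed.

Lemma fcoef_linear (T : finType) (y : T) :
  linear (fun a : fmod k T => fcoef a y : k^o).
Proof. by move=> c a b; rewrite fcoefP. Qed.

(* The right kA-linear projection of the fundamental module onto its direct
   summand kA, spanned by the Delta_tau f_R for tau in A. *)
Definition aut_proj (x : P) : aut_alg k E :=
  \sum_(tau : A) fcoef x (sgval tau) *: (basis k tau : aut_alg k E).

Lemma aut_proj_linear : linear aut_proj.
Proof.
move=> c x y; rewrite /aut_proj scaler_sumr -big_split /=; apply: eq_bigr => tau _.
by rewrite fcoefP scalerDl scalerA.
Qed.

Lemma aut_proj_rmul x b : aut_proj (fund_rmul x b) = aut_proj x * b.
Proof.
rewrite -[RHS]/(aut_mul (aut_proj x) b).
move: b; apply: fmod_ext => [||tau].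
- exact: (linear_comp aut_proj_linear (@fund_rmul_linearr _ _ _ x)).
- exact: aut_mul_linearr.
move: x; apply: fmod_ext => [||alpha].
- exact: (linear_comp aut_proj_linear (@fund_rmul_linearl _ _ _ (basis k tau))).
- exact: (linear_comp (@aut_mul_linearl _ _ _ (basis k tau)) aut_proj_linear).
rewrite fund_rmul_basis /aut_proj (linear_map_sum (@aut_mul_linearl _ _ _ (basis k tau))).
rewrite (reindex_inj (mulgI tau)) /=; apply: eq_bigr => sigma _.
rewrite (linear_mapZ (@aut_mul_linearl _ _ _ (basis k tau))) aut_mul_basis.
by rewrite !fcoef_basis (inj_eq (mulgI _)).
Qed.

Variable V : leftModule (aut_alg k E).

(** The map [aut_proj] tensored with [V], followed by the identification of kA (x) V with [V]. *)
Definition proj_act : tensor_left (fund_module k E) V -> V :=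
  tlift (fun (x : bi_right (fund_module k E)) (v : V) => lact (aut_proj x) v).

Lemma proj_act_balanced :
  balanced (fun (x : bi_right (fund_module k E)) (v : V) => lact (aut_proj x) v).
Proof.
split=> [v|x|x b v].
- exact: (@linear_comp k _ _ _ (fun a : aut_alg k E => lact a v) _
    (lact_linearl v) aut_proj_linear).
- exact: lact_linearr.
- by rewrite -lactM -aut_proj_rmul.
Qed.

Lemma proj_actE (x : P) v :
  proj_act (wtens (x : fund_module k E) v) = lact (aut_proj x) v.
Proof. exact: (tliftE proj_act_balanced). Qed.

Lemma proj_act_linear : linear proj_act.
Proof. exact: (tlift_linear proj_act_balanced). Qed.

Lemma fund_act_perm (s alpha : {perm E}) :
  fund_act k (permrel s) alpha = basis k (alpha * s)%g.
Proof.
apply: fund_actE; apply/fund_relP; split=> [e|a b]; first by rewrite permrelE.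
by rewrite permrelE => /eqP/perm_inj ->.
Qed.

(** Permutation relations permute the basis, so any coefficient can be read at the identity. *)
Lemma fund_lact_perm (s : {perm E}) (x : P) alpha :
  fcoef (fund_lact (basis k (permrel s)) x) (alpha * s)%g = fcoef x alpha.
Proof.
move: x; apply: (@fmod_ext k _ k^o) => [||beta].
- exact: (linear_comp (@fcoef_linear _ (alpha * s)%g) (@fund_lact_linearr _ _ _ _)).
- exact: fcoef_linear.
by rewrite fund_lact_basis fund_act_perm !fcoef_basis (inj_eq (mulIg _)).
Qed.

(** By [fund_rel_uniq], the coefficient is nonzero exactly when the identity is the permutation
    associated with [Q]. *)
Lemma fcoef_fund_act1 Q :
  fcoef (fund_act k Q (1%g : {perm E})) 1%g =
  ([forall e, (e, e) \in Q] && [forall p in Q, (p.1 <= p.2)%O])%:R.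
Proof.
have relE : fund_rel Q 1%g 1%g =
    [forall e, (e, e) \in Q] && [forall p in Q, (p.1 <= p.2)%O].
  apply/fund_relP/andP => [[h1 h2]|[/forallP h1 /forall_inP h2]]; split.
  - by apply/forallP => e; have := h1 e; rewrite perm1.
  - apply/forall_inP => -[a b] Qab; have := h2 a b.
    by rewrite invg1 !perm1; apply.
  - by move=> e; rewrite perm1.
  - by move=> a b; rewrite invg1 !perm1 => /h2.
rewrite -relE; case: (pickP (fund_rel Q 1%g)) => [beta h|h]; last first.
  by rewrite fund_act0 ?h => [|beta]; rewrite ?h //= /fcoef ffunE.
rewrite (fund_actE k h) mul1g fcoef_basis eq_sym.
case: (eqVneq beta 1%g) h => [-> -> //|nb h].
by case: (boolP (fund_rel Q _ 1)) => // h'; rewrite (fund_rel_uniq h h') eqxx in nb.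
Qed.

End FundamentalProjection.

(** * Columns and coordinates of S_{E,R}(X) *)

Section Columns.
Variables (k : comNzRingType) (d : Order.disp_t) (E : finPOrderType d) (X : finType).
Local Notation A := (poset_autT E).
Local Notation W := (fund_module k E).
Local Notation P := (fmod k {perm E}).
Implicit Types (q : S_obj W X) (phi psi : {set X * E}) (rho : {set E * X}).

Definition coefS rho q : k := fcoef (S_ev (basis k rho) q : P) 1%g.

Lemma coefS_linear rho : linear (fun q => coefS rho q : k^o).
Proof. exact: (linear_comp (@fcoef_linear k _ 1%g) (@S_ev_linear _ _ W X _)). Qed.

(** The coefficient at [alpha] for [rho] is the coefficient at the identity for [rho] composed on
    the left with the graph of the inverse of [alpha]. *)
Lemma coefS_eq0 q : (forall rho, coefS rho q = 0) -> q = 0.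
Proof.
move=> q0; apply: S_ev_eq0 => a; move: a; apply: fmod_ext => [||rho].
- exact: S_ev_linearl.
- by move=> c x y; rewrite scaler0 addr0.
apply/ffunP => alpha; rewrite ffunE -[LHS]/(fcoef _ alpha).
rewrite -(fund_lact_perm alpha^-1) mulgV.
rewrite -[RHS](q0 (rcomp (permrel alpha^-1) rho)); congr fcoef.
move: q {q0}; apply: S_ext => [||phi w].
- exact: (linear_comp (@fund_lact_linearr _ _ _ _) (@S_ev_linear _ _ W X _)).
- exact: S_ev_linear.
rewrite !S_evE -ccomp_basis -ccompA.
exact: (esym (fund_lactM _ _ _)).
Qed.

Definition colS phi : S_obj W X :=
  S_pi (L_tens (basis k phi) (basis k (1%g : {perm E}) : W)).

(** Delta_alpha f_R is the image of f_R under the graph of [alpha], and balancing moves that graph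
    into [phi]; hence the columns span. *)
Lemma colS_ext (U : lmodType k) (f g : S_obj W X -> U) : linear f -> linear g ->
  (forall phi, f (colS phi) = g (colS phi)) -> forall q, f q = g q.
Proof.
move=> lf lg fg; apply: S_ext => // a w; move: a; apply: fmod_ext => [||phi].
- apply: (linear_comp lf); apply: (linear_comp (@S_pi_linear _ _ W X)).
  exact: L_tens_linearl.
- apply: (linear_comp lg); apply: (linear_comp (@S_pi_linear _ _ W X)).
  exact: L_tens_linearl.
move: w; apply: fmod_ext => [||alpha].
- exact: (linear_comp lf (@S_pi_linearr _ _ _ W X _)).
- exact: (linear_comp lg (@S_pi_linearr _ _ _ W X _)).
suff -> : S_pi (L_tens (basis k phi) (basis k alpha : W)) =
    colS (rcomp phi (permrel alpha)) by [].
rewrite /colS -ccomp_basis; congr S_pi.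
have -> : (basis k alpha : W) =
    lact (basis k (permrel alpha) : corr_alg k E) (basis k (1%g : {perm E}) : W).
  by rewrite /= fund_lact_basis fund_act_perm mul1g.
by rewrite /L_tens -tens_balanced.
Qed.

Lemma coefS_col rho phi : coefS rho (colS phi) = (compatible rho phi)%:R.
Proof.
rewrite /coefS /colS S_evE ccomp_basis /= fund_lact_basis.
exact: fcoef_fund_act1.
Qed.

(** On f_R, acting by [tau] on the right or by its graph on the left gives the same basis element,
    and balancing moves the graph into [phi]. *)
Lemma colS_ract phi (tau : A) :
  S_ract (colS phi) (basis k tau : aut_alg k E) =
  colS (rcomp phi (permrel (sgval tau))).
Proof.
rewrite /colS S_ractE -ccomp_basis; congr S_pi.
have -> : bact (basis k (1%g : {perm E}) : W) (basis k tau : aut_alg k E) =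
    lact (basis k (permrel (sgval tau)) : corr_alg k E) (basis k (1%g : {perm E}) : W).
  by rewrite /= fund_lact_basis fund_act_perm mul1g fund_rmul_basis mulg1.
by rewrite /L_tens -tens_balanced.
Qed.

Lemma fcoef_ract (x : P) (tau : A) :
  fcoef x (sgval tau) = fcoef (fund_rmul x (basis k (tau^-1)%g)) 1%g.
Proof.
move: x; apply: (@fmod_ext k _ k^o) => [||alpha]; first exact: fcoef_linear.
- exact: (linear_comp (@fcoef_linear k _ 1%g) (@fund_rmul_linearl _ _ _ _)).
rewrite fund_rmul_basis !fcoef_basis -(inj_eq (mulgI (sgval (tau^-1)%g))).
by rewrite /= mulVg.
Qed.

Lemma coefS_ract rho q (tau : A) :
  fcoef (S_ev (basis k rho) q : P) (sgval tau) =
  coefS rho (S_ract q (basis k (tau^-1)%g : aut_alg k E)).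
Proof. by rewrite fcoef_ract /coefS S_ev_ract. Qed.

End Columns.

(** * Dual basis and the inverse of Psi *)

Section Inverse.
Variables (k : fieldType) (d : Order.disp_t) (E : finPOrderType d) (X : finType).
Local Notation W := (fund_module k E).
Local Notation P := (fmod k {perm E}).

(* A dual basis for the projective right kA-module S_{E,R}(X). *)
Lemma S_ER_dual_basis : exists u : {set X * E} -> {set E * X} -> k,
  forall q : S_obj W X,
  q = \sum_psi \sum_rho u psi rho *:
        S_ract (colS k psi) (aut_proj (S_ev (basis k rho) q : P)).
Proof.
have [u uE] := compatible_higman k E X; exists u.
apply: colS_ext => [||phi]; first exact: linear_id.
  have lin (psi : {set X * E}) (rho : {set E * X}) :
      linear (fun q : S_obj W X =>
        S_ract (colS k psi) (aut_proj (S_ev (basis k rho) q : P))).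
    apply: (linear_comp (@S_ract_linearr _ _ _ W X _)).
    exact: (linear_comp (@aut_proj_linear _ _ _) (@S_ev_linear _ _ W X _)).
  move=> c x y; rewrite scaler_sumr -big_split /=; apply: eq_bigr => psi _.
  rewrite scaler_sumr -big_split /=; apply: eq_bigr => rho _.
  by rewrite (lin psi rho) scalerDr !scalerA mulrC.
(* Coordinates separate elements. On a column, expanding [aut_proj] over [tau] turns the coordinate
   at [rho'] into the identity of [compatible_higman]. *)
apply/eqP; rewrite -subr_eq0; apply/eqP/coefS_eq0 => rho'.
rewrite (linear_mapB (coefS_linear rho')) coefS_col -uE.
apply/eqP; rewrite subr_eq0; apply/eqP/esym.
rewrite (linear_map_sum (coefS_linear rho')); apply: eq_bigr => psi _.
rewrite (linear_map_sum (coefS_linear rho')); apply: eq_bigr => rho _.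
rewrite (linear_mapZ (coefS_linear rho')) /aut_proj; congr (_ * _).
rewrite (linear_map_sum (@S_ract_linearr _ _ _ W X _)).
rewrite (linear_map_sum (coefS_linear rho')); apply: eq_bigr => tau _.
rewrite (linear_mapZ (@S_ract_linearr _ _ _ W X _)).
rewrite (linear_mapZ (coefS_linear rho')) coefS_ract !colS_ract !coefS_col.
by [].
Qed.

(** In the dual basis expansion of [q], tensored with [v], balancing moves the kA-coefficients onto
    [v]. The resulting vectors of [V] are values of [proj_act] on evaluations of the image under
    Psi, so the formula defines a left inverse [g] on the target. *)
Lemma Psi_ER_inverse (V : leftModule (aut_alg k E)) :
  exists g : S_ERV V X -> ftensor (S_ER k E) V X,
    [/\ linear g, cancel (Psi_ER V X) g & cancel g (Psi_ER V X)].
Proof.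
have [u uE] := S_ER_dual_basis.
pose g (s : S_ERV V X) : ftensor (S_ER k E) V X :=
  \sum_psi \sum_rho u psi rho *: stens (colS k psi) (proj_act (S_ev (basis k rho) s)).
have lg : linear g.
  have lin (psi : {set X * E}) (rho : {set E * X}) : linear (fun s : S_ERV V X =>
      stens (colS k psi) (proj_act (S_ev (basis k rho) s))).
    apply: (linear_comp (stens_linearr (V := V) (colS k psi))).
    exact: (linear_comp (@proj_act_linear _ _ _ V)
      (@S_ev_linear _ _ (tensor_left W V) X _)).
  move=> c x y; rewrite /g scaler_sumr -big_split /=; apply: eq_bigr => psi _.
  rewrite scaler_sumr -big_split /=; apply: eq_bigr => rho _.
  by rewrite (lin psi rho) scalerDr !scalerA mulrC.
have gK : cancel (Psi_ER V X) g.
  apply: tensor_ext => [||q v].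
  - exact: (linear_comp lg (@Psi_linear _ _ _ W V X)).
  - exact: linear_id.
  rewrite -/(stens q v) [in RHS](uE q) (linear_map_sum (stens_linearl v)).
  apply: eq_bigr => psi _; rewrite (linear_map_sum (stens_linearl v)).
  apply: eq_bigr => rho _; rewrite (linear_mapZ (stens_linearl v)) stens_ract.
  by rewrite S_ev_Psi proj_actE.
exists g; split=> //.
have linPg : linear (fun s => Psi_ER V X (g s)).
  exact: (linear_comp (@Psi_linear _ _ _ W V X) lg).
apply: S_ext => [||phi w] //.
move: w; apply: tensor_ext => [||x v].
- apply: (linear_comp linPg).
  exact: (linear_comp (@S_pi_linear _ _ (tensor_left W V) X)
    (@L_tensr_linear _ _ _ W V X phi)).
- exact: (linear_comp (@S_pi_linear _ _ (tensor_left W V) X)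
    (@L_tensr_linear _ _ _ W V X phi)).
(* The generators of the target are values of Psi, so the left inverse is also a right inverse. *)
- by rewrite -/(wtens (x : W) v) -PsiE gK.
Qed.

End Inverse.

Theorem theorem6p10 (k : fieldType) (d : Order.disp_t) (E : finPOrderType d)
    (V : leftModule (aut_alg k E)) (hV : simple_module V) :
  is_corr_iso (Psi_ER V).
Proof.
pose g X := projT1 (cid (Psi_ER_inverse X V)).
have gP X : [/\ linear (g X), cancel (Psi_ER V X) (g X) & cancel (g X) (Psi_ER V X)].
  by rewrite /g; case: cid.
have glin X : linear (g X) by case: (gP X).
have gK X : cancel (Psi_ER V X) (g X) by case: (gP X).
have Kg X : cancel (g X) (Psi_ER V X) by case: (gP X).
(* The inverses, chosen separately for each [X], inherit naturality from Psi. *)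
have gnat (X Y : finType) (phi : corr k Y X) (s : S_ERV V X) :
    g Y (fmap phi s) = fmap phi (g X s).
  by rewrite -{1}(Kg X s) -hcomp_natural gK.
by exists (CorrHom glin gnat).
Qed.
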